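(* Let $k$ be an algebraically closed field with a finite subfield $\mathbb{F}_q$, let $V$ be an $n$-dimensional $k$-vector space with an $\mathbb{F}_q$-structure, and let $(\mu;\nu)$ be a bipartition of $n$. Then $$|\mathcal{O}_{\mu;\nu}(\mathbb{F}_q)|=\frac{q^{n^2-b(\mu;\nu)}\varphi_n(q^{-1})}{\prod_{h\in J}\varphi_{n_{l_h}-1}(q^{-1})\prod_{h\notin J}\varphi_{n_{l_h}}(q^{-1})}.$$
   Context: $\varphi_m(t)=\prod_{r=1}^m(1-t^r)$ (so $\varphi_0=1$). A partition is a non-increasing sequence $\lambda=(\lambda_1,\lambda_2,\dots)$ of natural numbers that is eventually $0$; $|\lambda|=\sum_i\lambda_i$, $l(\lambda)$ is the number of nonzero terms, and $n(\lambda)=\sum_{i\ge1}(i-1)\lambda_i$. A bipartition of $n$ is a pair of partitions $(\mu;\nu)$ such that $\mu+\nu$ (termwise sum) is a partition of $n$. Put $\lambda=\mu+\nu$ and $b(\mu;\nu)=|\nu|+2n(\mu)+2n(\nu)$. Let $l_1>l_2>\dots>l_s\geq 1$ be the distinct nonzero parts of $\lambda$, let $n_{l_h}>0$ be the multiplicity of $l_h$ in $\lambda$. The sequences $\mu_i$ and $\nu_i$ are constant on the set of $i$ with $\lambda_i=l_h$; call the constant values $j_h$ and $k_h$ respectively. Set $k_0=\infty$ and $j_{s+1}=0$, and $$J=\{h\in\{1,\dots,s\} : j_h>j_{h+1}\text{ and }k_h<k_{h-1}\}.$$ The product over $h\notin J$ runs over $h\in\{1,\dots,s\}\setminus J$.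 Let $\mathcal{N}\subset\mathrm{End}(V)$ be the set of nilpotent endomorphisms; $G=\mathrm{GL}(V)$ acts on $V\times\mathcal{N}$ by $g(v,x)=(gv,gxg^{-1})$. A Jordan basis for $x\in\mathcal{N}$ of Jordan type $\lambda$ is a basis $\{v_{ij} : 1\le i\le l(\lambda),1\le j\le\lambda_i\}$ of $V$ with $xv_{ij}=v_{i,j-1}$ for $j>1$ and $xv_{i1}=0$. $\mathcal{O}_{\mu;\nu}$ is the $G$-orbit consisting of those $(v,x)$ such that $x$ has Jordan type $\mu+\nu$ and admits a Jordan basis with $v=\sum_i v_{i\mu_i}$ (with $v_{i0}=0$). $\mathcal{O}_{\mu;\nu}(\mathbb{F}_q)$ is the set of $\mathbb{F}_q$-rational points of $\mathcal{O}_{\mu;\nu}$ (taking $V=k^n$ with its standard $\mathbb{F}_q$-structure: the pairs $(v,x)\in\mathcal{O}_{\mu;\nu}$ with $v\in\mathbb{F}_q^n$ and $x$ a matrix with entries in $\mathbb{F}_q$). *)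

(* Defs.v *)
From mathcomp Require Import all_boot all_order all_algebra.
From mathcomp Require Import boolp.

Set Implicit Arguments.
Unset Strict Implicit.
Unset Printing Implicit Defensive.

Import GRing.Theory.

(* A partition (lambda_1, lambda_2, ...) is encoded by the sequence of its
   nonzero terms: lambda_(i+1) is [nth 0 lam i], which is 0 beyond [size lam].
   Hence |lambda| is [sumn lam] and l(lambda) is [size lam]. *)
Definition is_partition (lam : seq nat) : bool :=
  sorted geq lam && (0 \notin lam).

Definition padd (mu nu : seq nat) : seq nat :=
  mkseq (fun i => nth 0 mu i + nth 0 nu i) (maxn (size mu) (size nu)).

Definition is_bipartition (n : nat) (mu nu : seq nat) : bool :=
  [&& is_partition mu, is_partition nu,
      is_partition (padd mu nu) & sumn (padd mu nu) == n].

(* n(lambda) = \sum_(i >= 1) (i - 1) * lambda_i, with i shifted by one. *)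
Definition nstat (lam : seq nat) : nat :=
  \sum_(i < size lam) i * nth 0 lam i.

Definition bstat (mu nu : seq nat) : nat :=
  sumn nu + 2 * nstat mu + 2 * nstat nu.

(* Since lam is non-increasing, [undup] lists the distinct parts in decreasing
   order. Indices are shifted by one: [dpart lam h] is l_(h+1). *)
Definition ndparts (lam : seq nat) : nat := size (undup lam).

Definition dpart (lam : seq nat) (h : nat) : nat := nth 0 (undup lam) h.

Definition mult (lam : seq nat) (h : nat) : nat := count_mem (dpart lam h) lam.

(* The value of mu at the first index i such that lam_i = l_(h+1); it is 0 for
   h = ndparts lam, which is the convention j_(s+1) = 0. *)
Definition block_val (lam mu : seq nat) (h : nat) : nat :=
  if h < ndparts lam then nth 0 mu (index (dpart lam h) lam) else 0.

(* The disjunct [h == 0] is the convention k_0 = oo. *)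
Definition Jset (mu nu : seq nat) : {set 'I_(ndparts (padd mu nu))} :=
  let j := block_val (padd mu nu) mu in
  let k := block_val (padd mu nu) nu in
  [set h : 'I_(ndparts (padd mu nu)) |
    (j h.+1 < j h) && ((h == 0 :> nat) || (k h < k h.-1))].

Local Open Scope ring_scope.

Definition phi (R : nzRingType) (m : nat) (t : R) : R :=
  \prod_(1 <= r < m.+1) (1 - t ^+ r).

Definition nilpotent_mx (k : fieldType) (n : nat) (x : 'M[k]_n) : Prop :=
  exists m : nat, x ^+ m = 0.

(* [e i j] is v_(i+1, j): i is shifted by one as above, but j is not, so that
   e i 0 = 0. Values of e outside j <= lam_i, i < size lam are irrelevant. *)
Definition jordan_basis (k : fieldType) (n : nat) (lam : seq nat)
    (x : 'M[k]_n) (e : nat -> nat -> 'cV[k]_n) : Prop :=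
  [/\ basis_of {: 'cV[k]_n}%VS
        [seq e i j | i <- iota 0 (size lam), j <- iota 1 (nth 0%N lam i)],
      forall i, (i < size lam)%N -> e i 0%N = 0 &
      forall i j, (i < size lam)%N -> (0 < j <= nth 0%N lam i)%N ->
        x *m e i j = e i j.-1].

Definition orbit_munu (k : fieldType) (n : nat) (mu nu : seq nat)
    (v : 'cV[k]_n) (x : 'M[k]_n) : Prop :=
  nilpotent_mx x /\
  exists2 e : nat -> nat -> 'cV[k]_n,
    jordan_basis (padd mu nu) x e &
    v = \sum_(i < size (padd mu nu)) e i (nth 0%N mu i).

(* F is the finite subfield, embedded in k by iota; a rational point of k^n x
   M_n(k) is one with all coordinates in the image of iota. *)
Definition orbit_points (k : fieldType) (F : finFieldType)
    (iota : {rmorphism F -> k}) (n : nat) (mu nu : seq nat) :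
    {set 'cV[F]_n * 'M[F]_n} :=
  [set p | `[< orbit_munu mu nu (map_mx iota p.1) (map_mx iota p.2) >]].

(* Main.v *)
Require Import Defs.
From mathcomp Require Import all_boot all_order all_algebra mxabelem.
From mathcomp Require Import zify ring boolp.

(** Why the formula holds.

    Let N be the Jordan matrix of type lam = mu + nu. Acting on row vectors, a
    Jordan basis for x is an invertible Q with N Q = Q x^T, and the condition on
    v becomes v^T = s Q, where s is the sum of the v_(i, mu_i) of the standard
    basis. So the orbit is the orbit of (s, N) under the general linear group,
    over any field ([orbit_rowsP]).

    Two facts make its rational points countable. The first describes the
    vectors s Q, where Q is invertible and commutes with N: they are the vectors
    with no coordinate above mu and, for each block h of J, with some nonzero
    coordinate at the height j_h of that block ([generic_orbit],
    [orbit_generic]). This does not depend on the field. The second is that over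
    a finite field the number of Jordan bases of y of type lam can be computed
    by choosing the tops of the chains one after the other; it depends only on
    the ranks of the powers of y ([card_intertwiners_rank]). Those ranks do not
    change when the field grows, and N has at least one Jordan basis; so a matrix
    over F with a Jordan basis of type lam over k has one over F
    ([intertwiner_exists]).

    Hence a rational point of the orbit is (c Q, Q^-1 N Q), up to transposition,
    with Q in GL_n(F) and c one of the vectors above, and the pairs (Q, c) giving
    a fixed point are as many as the matrices Z in GL_n(F) commuting with N
    ([card_orbit_points]):

      number of points * number of Z = |GL_n(F)| * number of c.

    The number of c is q^|mu| times the product of 1 - q^-m_h over h in J, with
    m_h the multiplicity of block h ([card_generic_set]). The number of Z is
    q^(n + 2 n(lam)) times the product of phi_(m_h)(1/q) over all h
    ([card_centralizer_rat]), and |GL_n(F)| is q^(n^2) phi_n(1/q). Since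
    phi_m = phi_(m-1) (1 - q^-m), the factors of the blocks in J turn phi_(m_h)
    into phi_(m_h - 1), and the exponent is n^2 + |mu| - n - 2 n(lam), which is
    n^2 - b(mu; nu). *)

Set Implicit Arguments.
Unset Strict Implicit.
Unset Printing Implicit Defensive.

Import Order.TTheory GRing.Theory Num.Theory.
Local Open Scope ring_scope.

(** * Positions in a Young diagram *)
Section Positions.
Variable lam : seq nat.

Local Notation part i := (nth 0%N lam i).

(** The n cells of the diagram of lam number the vectors of a Jordan basis, chain
    after chain. Cell r lies in chain [blk r] at height [off r], and [pos] is the
    converse numbering. Both coordinates start at 0, so that height j carries the
    vector v_(i, j+1) and a chain i has its kernel vector at height 0. *)
Definition blk (r : nat) : nat := reshape_index lam r.
Definition off (r : nat) : nat := reshape_offset lam r.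
Definition pos (i j : nat) : nat := flatten_index lam i j.

Lemma blk_lt r : (r < sumn lam)%N -> (blk r < size lam)%N.
Proof. exact: reshape_indexP. Qed.

Lemma off_lt r : (r < sumn lam)%N -> (off r < part (blk r))%N.
Proof. exact: reshape_offsetP. Qed.

Lemma posK r : pos (blk r) (off r) = r.
Proof. exact: reshape_indexK. Qed.

Lemma pos_lt i j : (j < part i)%N -> (pos i j < sumn lam)%N.
Proof. exact: flatten_indexP. Qed.

Lemma blk_pos i j : (j < part i)%N -> blk (pos i j) = i.
Proof. exact: flatten_indexKl. Qed.

Lemma off_pos i j : (j < part i)%N -> off (pos i j) = j.
Proof. exact: flatten_indexKr. Qed.

Lemma posD i j a : pos i (j + a) = (pos i j + a)%N.
Proof. by rewrite /pos /flatten_index addnA. Qed.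

Lemma pos_inj i j i' j' : (j < part i)%N -> (j' < part i')%N ->
  pos i j = pos i' j' -> i = i' /\ j = j'.
Proof.
move=> hj hj' e; split; first by rewrite -(blk_pos hj) e blk_pos.
by rewrite -(off_pos hj) e off_pos.
Qed.

Lemma pos_sub r a : (a <= off r)%N -> pos (blk r) (off r - a) = (r - a)%N.
Proof.
move=> h; rewrite -[in RHS](posK r) -[in RHS](subnK h) posD addnK //.
Qed.

Lemma blk_sub r a : (r < sumn lam)%N -> (a <= off r)%N -> blk (r - a) = blk r.
Proof.
move=> hr h; rewrite -pos_sub // blk_pos //.
exact: leq_ltn_trans (leq_subr _ _) (off_lt hr).
Qed.

Lemma off_sub r a : (r < sumn lam)%N -> (a <= off r)%N ->
  off (r - a) = (off r - a)%N.
Proof.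
move=> hr h; rewrite -pos_sub // off_pos //.
exact: leq_ltn_trans (leq_subr _ _) (off_lt hr).
Qed.

Lemma off_le r : (r < sumn lam)%N -> (off r <= r)%N.
Proof. by move=> hr; rewrite -[X in (_ <= X)%N]posK /pos /flatten_index leq_addl. Qed.

Lemma positionsE :
  [seq (blk r, off r) | r <- iota 0 (sumn lam)] =
  [seq (i, j) | i <- iota 0 (size lam), j <- iota 0 (part i)].
Proof.
set ss := [seq [seq (i, j) | j <- iota 0 (part i)] | i <- iota 0 (size lam)].
have shE : shape ss = lam.
  rewrite /shape /ss -map_comp.
  rewrite (eq_map (g := fun i => part i)); last first.
    by move=> i /=; rewrite size_map size_iota.
  by rewrite map_nth_iota0 // take_size.
have sz : size (flatten ss) = sumn lam by rewrite size_flatten shE.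
apply: (@eq_from_nth _ (0, 0)%N); first by rewrite size_map size_iota sz.
move=> r; rewrite size_map size_iota => hr.
rewrite (nth_map 0%N) ?size_iota // nth_iota // add0n nth_flatten shE.
rewrite -/(blk r) -/(off r) (nth_map 0%N) ?size_iota ?blk_lt //.
rewrite nth_iota ?blk_lt // add0n (nth_map 0%N) ?size_iota ?off_lt //.
by rewrite nth_iota ?off_lt.
Qed.

Lemma big_positions (R : Type) (idx : R) (op : Monoid.law idx)
    (f : nat -> nat -> R) :
  \big[op/idx]_(r < sumn lam) f (blk r) (off r) =
  \big[op/idx]_(i < size lam) \big[op/idx]_(j < part i) f i j.
Proof.
rewrite -(big_mkord xpredT (fun r => f (blk r) (off r))) /index_iota subn0.
rewrite -(big_map (fun r => (blk r, off r)) xpredT (fun p => f p.1 p.2)).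
rewrite positionsE big_allpairs_dep /=.
rewrite -(big_mkord xpredT (fun i => \big[op/idx]_(j < part i) f i j)).
rewrite /index_iota subn0; apply: eq_bigr => i _.
by rewrite -(big_mkord xpredT (fun j => f i j)) /index_iota subn0.
Qed.

End Positions.

(** The part of a chain cut out by the condition j + 1 = mu_i: a single vector, or
    nothing when mu_i = 0. *)
Lemma sum_pick (R : nzRingType) (V : lmodType R) (g : nat -> V) p m : (m <= p)%N ->
  \sum_(j < p) (j.+1 == m)%:R *: g j = if (0 < m)%N then g m.-1 else 0.
Proof.
case: m => [_|m mp]; first by rewrite big1 // => j _; rewrite scale0r.
rewrite (bigD1 (Ordinal mp)) //= eqxx scale1r big1 ?addr0 // => j.
by rewrite -val_eqE eqSS /= => /negbTE ->; rewrite scale0r.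
Qed.

(** * The Jordan matrix and its intertwiners *)
Section UnitRow.
Variable K : fieldType.

(** Indexed by nat rather than by an ordinal, so that positions can be computed
    freely; it is 0 beyond d. *)
Definition unit_row d (p : nat) : 'rV[K]_d := \row_s (s == p :> nat)%:R.

Lemma unit_row_mul d n (r : 'I_d) (A : 'M[K]_(d, n)) :
  unit_row d r *m A = row r A.
Proof.
by rewrite rowE; congr (_ *m _); apply/rowP=> s; rewrite !mxE eqxx.
Qed.

Lemma row_unit_row d (z : 'rV[K]_d) : z = \sum_(r < d) z 0 r *: unit_row d r.
Proof.
rewrite [LHS]row_sum_delta; apply: eq_bigr => r _; congr (_ *: _).
by apply/rowP=> s; rewrite !mxE eqxx.
Qed.

End UnitRow.

Section JordanMatrix.
Variables (K : fieldType) (lam : seq nat).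
Local Notation n := (sumn lam).
Local Notation part i := (nth 0%N lam i).
Local Notation blk := (blk lam).
Local Notation off := (off lam).
Local Notation pos := (pos lam).
Local Notation E := (unit_row K n).

Definition jordan_mx : 'M[K]_n :=
  \matrix_(r, s) ((r == s.+1 :> nat) && (0 < off r)%N)%:R.
Local Notation N := jordan_mx.

(** N moves each basis row one step down its chain. *)
Lemma unit_row_jordanX p a : (p < n)%N ->
  E p *m N ^+ a = if (a <= off p)%N then E (p - a)%N else 0.
Proof.
elim: a p => [|a IHa] p hp; first by rewrite expr0 mulmx1 subn0.
have step : E p *m N = if (0 < off p)%N then E p.-1 else 0.
  rewrite -[p]/(val (Ordinal hp)) unit_row_mul.
  apply/rowP=> s; rewrite !mxE /=; case: ifP => h; rewrite ?andbF ?andbT ?mxE //.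
  by have := leq_trans h (off_le hp); case: p {hp h} => //= p _; rewrite eqSS eq_sym.
rewrite exprS -mulmxE mulmxA step; case: posnP => h; first by rewrite h mul0mx.
have hp1 : (p.-1 < n)%N by exact: leq_ltn_trans (leq_pred _) hp.
rewrite IHa // -subn1 off_sub // leq_subRL // add1n.
by rewrite -subnDA add1n.
Qed.

Lemma unit_row_jordanX_pos i j a : (j < part i)%N ->
  E (pos i j) *m N ^+ a = if (a <= j)%N then E (pos i (j - a)) else 0.
Proof.
move=> h; rewrite unit_row_jordanX ?pos_lt // off_pos //.
case: leqP => // haj; congr E.
by rewrite -(@pos_sub lam) off_pos // blk_pos.
Qed.

Lemma jordan_mx_nilpotent : N ^+ n = 0.
Proof.
apply/row_matrixP=> r; rewrite -unit_row_mul row0 unit_row_jordanX //.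
case: leqP => // h; have := leq_ltn_trans (leq_trans h (off_le (ltn_ord r))).
by move/(_ _ (ltn_ord r)); rewrite ltnn.
Qed.

Lemma jordan_kerP (z : 'rV[K]_n) a :
  reflect (forall r : 'I_n, (a <= off r)%N -> z 0 r = 0) (z *m N ^+ a == 0).
Proof.
apply: (iffP eqP) => [hz r har|hz]; last first.
  rewrite [z]row_unit_row mulmx_suml big1 // => r _.
  rewrite -scalemxAl unit_row_jordanX //.
  by case: leqP => [/hz ->|_]; rewrite ?scale0r ?scaler0.
have hlt : (r - a < n)%N by exact: leq_ltn_trans (leq_subr _ _) (ltn_ord r).
have := congr1 (fun u : 'rV_n => u 0 (Ordinal hlt)) hz.
rewrite [z in z *m _]row_unit_row mulmx_suml summxE !mxE (bigD1 r) //=.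
rewrite -scalemxAl unit_row_jordanX // har !mxE /= eqxx mulr1.
rewrite big1 ?addr0 // => s hs; rewrite -scalemxAl unit_row_jordanX //.
case: leqP => has; last by rewrite scaler0 mxE.
rewrite !mxE /=; case: eqP => [e|_]; last by rewrite mulr0.
case/eqP: hs; apply: val_inj => /=.
have h1 := leq_trans har (off_le (ltn_ord r)).
have h2 := leq_trans has (off_le (ltn_ord s)).
by rewrite -(subnK h1) -(subnK h2) e.
Qed.

Section Chains.
Variable y : 'M[K]_n.

(** The matrix whose rows are the chains hanging from prescribed tops [w i]. *)
Definition chain_mx (w : nat -> 'rV[K]_n) : 'M[K]_n :=
  \matrix_r (w (blk r) *m y ^+ (part (blk r) - (off r).+1)).

Lemma chain_mxE w i j : (j < part i)%N ->
  E (pos i j) *m chain_mx w = w i *m y ^+ (part i - j.+1).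
Proof.
move=> h; have hp := pos_lt h; rewrite -[pos i j]/(val (Ordinal hp)).
by rewrite unit_row_mul rowK /= blk_pos // off_pos.
Qed.

Lemma jordan_comm_row (Q : 'M[K]_n) :
  (forall i j, (j < part i)%N ->
     E (pos i j) *m Q *m y = if (0 < j)%N then E (pos i j.-1) *m Q else 0) ->
  N *m Q = Q *m y.
Proof.
move=> h; apply/row_matrixP=> r; rewrite -!unit_row_mul !mulmxA.
rewrite -(posK lam r) h ?off_lt // -[N]expr1 unit_row_jordanX_pos ?off_lt //.
by case: posnP => _; rewrite ?mul0mx ?subn1.
Qed.

Lemma chain_mx_comm w :
  (forall i, (0 < part i)%N -> w i *m y ^+ part i = 0) ->
  N *m chain_mx w = chain_mx w *m y.
Proof.
move=> hw; apply: jordan_comm_row => i j h; rewrite chain_mxE // -mulmxA.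
rewrite [y in _ *m (_ *m y)](_ : y = y ^+ 1) // mulmxE -exprD addn1 -subSn //.
rewrite subSS; case: posnP => [->|j0]; last first.
  by rewrite chain_mxE ?prednK // ltnW.
by rewrite subn0 hw //; case: (part i) h.
Qed.

Lemma jordan_commX (Q : 'M[K]_n) a : N *m Q = Q *m y ->
  N ^+ a *m Q = Q *m y ^+ a.
Proof.
move=> h; elim: a => [|a IHa]; first by rewrite !expr0 mulmx1 mul1mx.
by rewrite exprS -mulmxE -mulmxA IHa mulmxA h -mulmxA !mulmxE -exprS.
Qed.

Lemma jordan_rankX (Q : 'M[K]_n) a : Q \in unitmx -> N *m Q = Q *m y ->
  \rank (y ^+ a) = \rank (N ^+ a).
Proof.
move=> uQ hQ; rewrite -[RHS](mxrankMfree _ (_ : row_free Q)) ?row_free_unit //.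
by rewrite (jordan_commX _ hQ) eqmxMfull ?row_full_unit.
Qed.

Lemma jordan_commV (Q Q0 : 'M[K]_n) : Q0 \in unitmx ->
  N *m Q0 = Q0 *m y -> N *m Q = Q *m y ->
  N *m (Q *m invmx Q0) = Q *m invmx Q0 *m N.
Proof.
move=> uQ0 hQ0 hQ; rewrite -[N in RHS](mulmxK uQ0) hQ0 !mulmxA mulmxKV //.
by rewrite hQ.
Qed.

Lemma jordan_row_top (Q : 'M[K]_n) i j : N *m Q = Q *m y -> (j < part i)%N ->
  E (pos i j) *m Q = E (pos i (part i).-1) *m Q *m y ^+ (part i - j.+1).
Proof.
move=> h hj; rewrite -mulmxA -jordan_commX // mulmxA unit_row_jordanX_pos.
  rewrite ifT; last by lia.
  by congr (E (pos _ _) *m _); lia.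
by lia.
Qed.

Lemma jordan_row_top_ker (Q : 'M[K]_n) i : N *m Q = Q *m y ->
  (0 < part i)%N -> E (pos i (part i).-1) *m Q *m y ^+ part i = 0.
Proof.
move=> h hi; rewrite -mulmxA -jordan_commX // mulmxA unit_row_jordanX_pos.
  by rewrite ifF ?mul0mx //; lia.
by lia.
Qed.

(** The kernel of Q is stable under N. If it contained a nonzero z, then the last
    nonzero z N^a would be a nonzero element of it killed by N. So the rows of Q
    are independent as soon as those at the bottoms of the chains are. *)
Lemma jordan_unitmx (Q : 'M[K]_n) : N *m Q = Q *m y ->
  (forall z : 'rV_n, z *m N = 0 -> z *m Q = 0 -> z = 0) -> Q \in unitmx.
Proof.
move=> hQ hker; rewrite -row_free_unit; apply: inj_row_free => z zQ.
have zNQ a : z *m N ^+ a *m Q = 0.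
  by rewrite -mulmxA jordan_commX // mulmxA zQ mul0mx.
suff : forall a, z *m N ^+ (n - a) = 0.
  by move/(_ n); rewrite subnn expr0 mulmx1.
elim=> [|a IHa]; first by rewrite subn0 jordan_mx_nilpotent mulmx0.
case: (ltnP a n) => h; last first.
  by have -> : (n - a.+1 = n - a)%N by lia.
apply: hker; rewrite ?zNQ // -mulmxA mulmxE.
by rewrite -exprSr subnSK.
Qed.

End Chains.
End JordanMatrix.

(** * Orbits of the centralizer on vectors *)
Section Transitivity.
Variables (K : fieldType) (lam : seq nat).
Local Notation n := (sumn lam).
Local Notation part i := (nth 0%N lam i).
Local Notation blk := (blk lam).
Local Notation off := (off lam).
Local Notation pos := (pos lam).
Local Notation E := (unit_row K n).
Local Notation N := (jordan_mx K lam).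

Definition below (a : nat -> nat) (c : 'rV[K]_n) : Prop :=
  forall r : 'I_n, (a (blk r) <= off r)%N -> c 0 r = 0.

Lemma jordan_image_support (z : 'rV[K]_n) a (s : 'I_n) :
  (z *m N ^+ a) 0 s != 0 -> (off s + a < part (blk s))%N.
Proof.
apply: contraNT; rewrite -leqNgt => h.
rewrite [z]row_unit_row mulmx_suml summxE big1 // => r _.
rewrite -scalemxAl unit_row_jordanX // !mxE.
case: leqP => har; rewrite !mxE ?mulr0 //; case: eqP => [e|_]; rewrite ?mulr0 //.
move: h; rewrite e blk_sub // off_sub // subnK //.
by rewrite leqNgt off_lt.
Qed.

(** Commuting with N preserves the kernels and the images of its powers: the first
    inequality comes from the kernels, the second from the images. *)
Lemma centralizer_entry (Q : 'M[K]_n) (r s : 'I_n) : N *m Q = Q *m N ->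
  Q r s != 0 ->
  (off s <= off r)%N /\ (part (blk r) - off r <= part (blk s) - off s)%N.
Proof.
move=> hQ nz; have hr := off_lt (ltn_ord r).
have Er : E r *m Q = row r Q by rewrite unit_row_mul.
split.
  rewrite leqNgt; apply: contraNN nz => h.
  have /jordan_kerP/(_ s h) : row r Q *m N ^+ (off r).+1 == 0.
    rewrite -Er -mulmxA -jordan_commX // mulmxA unit_row_jordanX //.
    by rewrite ltnn mul0mx.
  by rewrite mxE => ->.
have := @jordan_image_support (E (pos (blk r) (part (blk r)).-1) *m Q)
  (part (blk r) - (off r).+1) s.
rewrite -jordan_row_top // posK Er mxE => /(_ nz).
by have := off_lt (ltn_ord s); lia.
Qed.

(** For every bipartition (a; b) of lam the span of the basis vectors of height
    below a is a sum of spaces (ker N^a_i) :&: (im N^b_i), so it is stable under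
    the centralizer. The two inequalities of [centralizer_entry] handle the
    chains before and after the given one respectively. *)
Lemma centralizer_below (a b : nat -> nat) (Q : 'M[K]_n) (c : 'rV[K]_n) :
  (forall i, part i = (a i + b i)%N) ->
  {homo a : i j / (i <= j)%N >-> (j <= i)%N} ->
  {homo b : i j / (i <= j)%N >-> (j <= i)%N} ->
  N *m Q = Q *m N -> below a c -> below a (c *m Q).
Proof.
move=> hab ha hb hQ hc s hs; rewrite mxE big1 // => r _.
have [h|h] := leqP (a (blk r)) (off r); first by rewrite hc ?mul0r.
suff -> : Q r s = 0 by rewrite mulr0.
apply: contraTeq hs => /(centralizer_entry hQ)[h1 h2]; rewrite -ltnNge.
have hr := off_lt (ltn_ord r); have hs := off_lt (ltn_ord s).
have := hab (blk r); have := hab (blk s).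
case: (leqP (blk s) (blk r)) => hrs; first by have := ha _ _ hrs; lia.
by have := hb _ _ (ltnW hrs); lia.
Qed.

Section Bipartition.
Variables mu nu : nat -> nat.
Hypothesis munu : forall i, part i = (mu i + nu i)%N.
Hypothesis mu_dec : {homo mu : i j / (i <= j)%N >-> (j <= i)%N}.
Hypothesis nu_dec : {homo nu : i j / (i <= j)%N >-> (j <= i)%N}.

(** The vector of the base point: the sum of the v_(i, mu_i). *)
Definition std_vec : 'rV[K]_n := \row_r ((off r).+1 == mu (blk r))%:R.

(** Order the indices with mu_i > 0 by growing mu and decreasing nu; the
    submodule generated by v_(i, mu_i) under the centralizer grows with i in this
    order. The maximal elements are exactly the indices in the blocks of J
    (lemma [in_Jset]). *)
Definition maximal (i : nat) : bool :=
  (0 < mu i)%N && [forall i' : 'I_(size lam),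
    (mu i <= mu i')%N && (nu i' <= nu i)%N ==> (part i' == part i)].

(** The candidate for the orbit of [std_vec]: the stable space of (mu; nu) minus
    the stable spaces obtained by lowering mu by 1 on one block of J. *)
Definition generic (c : 'rV[K]_n) : Prop :=
  below mu c /\ forall i, (i < size lam)%N -> maximal i ->
    exists r : 'I_n,
      [/\ part (blk r) = part i, (off r).+1 = mu (blk r) & c 0 r != 0].

Lemma part_mu i i' : part i = part i' -> mu i = mu i'.
Proof.
have := munu i; have := munu i'.
by case/orP: (leq_total i i') => h; have := mu_dec h; have := nu_dec h; lia.
Qed.

Lemma maximalP i i' : maximal i -> (i' < size lam)%N ->
  (mu i <= mu i')%N -> (nu i' <= nu i)%N -> part i' = part i.
Proof.
case/andP=> _ /forallP h hi' h1 h2; have /implyP := h (Ordinal hi').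
by rewrite /= h1 h2 => /(_ isT)/eqP.
Qed.

Lemma mu_gt0_lt i : (0 < mu i)%N -> (i < size lam)%N.
Proof.
move=> h; rewrite ltnNge; apply/negP=> /(nth_default 0%N) e.
by have := munu i; lia.
Qed.

(** Maximise mu_t - nu_t among the indices above i; the constant nu_i keeps the
    quantity in nat. *)
Lemma maximal_above i : (0 < mu i)%N ->
  exists i', [/\ maximal i', (mu i <= mu i')%N & (nu i' <= nu i)%N].
Proof.
move=> hi; have hm := mu_gt0_lt hi.
pose P (t : 'I_(size lam)) := (mu i <= mu t)%N && (nu t <= nu i)%N.
have P0 : P (Ordinal hm) by rewrite /P /= !leqnn.
case: (arg_maxnP (fun t : 'I__ => mu t + (nu i - nu t))%N P0) => t /andP[h1 h2] tmax.
exists t; split=> //; rewrite /maximal (leq_trans hi h1) /=.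
apply/forallP=> t'; apply/implyP=> /andP[h3 h4]; apply/eqP.
have /tmax : P t' by rewrite /P (leq_trans h1 h3) (leq_trans h4 h2).
by have := munu t; have := munu t'; lia.
Qed.

Lemma std_vec_below : below mu std_vec.
Proof. by move=> r h; rewrite mxE; case: eqP => // e; lia. Qed.

(** If all end coordinates of the image of [std_vec] vanished on the block of a
    maximal i, the image would lie in the stable space of the bipartition with mu
    lowered and nu raised by 1 on that block. Maximality of i says precisely that
    this is still a bipartition. Going back by the inverse, [std_vec] itself
    would lie there, which is false. *)
Lemma generic_orbit (Q : 'M[K]_n) : Q \in unitmx -> N *m Q = Q *m N ->
  generic (std_vec *m Q).
Proof.
move=> uQ hQ; split; first exact: (centralizer_below munu mu_dec nu_dec hQ std_vec_below).
move=> i hi mi; apply: contrapT => hex.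
have mu0 : (0 < mu i)%N by case/andP: mi.
(* (a; b) lowers mu and raises nu by 1 on the block of i. *)
pose d t : nat := part t == part i.
pose a t := (mu t - d t)%N; pose b t := (nu t + d t)%N.
have dE t : d t = 0%N \/ [/\ d t = 1%N, part t = part i & mu t = mu i].
  by rewrite /d; case: eqP => [e|_]; [right; split=> //; exact: part_mu|left].
have hab t : part t = (a t + b t)%N.
  by rewrite /a /b; have := munu t; case: (dE t) => [->|[-> _ ->]]; lia.
have mi_lt t : (0 < mu t)%N -> (mu i <= mu t)%N -> (nu t <= nu i)%N -> part t = part i.
  by move=> h; apply: maximalP => //; exact: mu_gt0_lt.
have mu_lt t : part t != part i -> (mu i <= mu t)%N -> (nu i < nu t)%N.
  by move=> h1 h2; rewrite ltnNge; apply: contraNN h1 => /mi_lt -> //; lia.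
have ha : {homo a : t t' / (t <= t')%N >-> (t' <= t)%N}.
  move=> t t' htt; rewrite /a; have := mu_dec htt; have := nu_dec htt.
  have := munu t; have := munu i; have := munu t'.
  case: (dE t) => [->|[-> h1 h2]]; first by lia.
  case: (dE t') => [h3|[-> _ _]]; last by lia.
  have /mu_lt : part t' != part i by move: h3; rewrite /d; case: eqP.
  by lia.
have hb : {homo b : t t' / (t <= t')%N >-> (t' <= t)%N}.
  move=> t t' htt; rewrite /b; have := mu_dec htt; have := nu_dec htt.
  have := munu t; have := munu i; have := munu t'.
  case: (dE t') => [->|[-> h1 h2]]; first by lia.
  case: (dE t) => [h3|[-> _ _]]; last by lia.
  have /mu_lt : part t != part i by move: h3; rewrite /d; case: eqP.
  by lia.
have cb : below a (std_vec *m Q).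
  move=> r har; case: (leqP (mu (blk r)) (off r)) => h.
    exact: (centralizer_below munu mu_dec nu_dec hQ std_vec_below).
  case: (dE (blk r)) => [e|[e e1 e2]]; first by move: har; rewrite /a e; lia.
  apply/eqP/negPn/negP=> nz; apply: hex; exists r; split=> //.
  by move: har; rewrite /a e; lia.
have hV : N *m invmx Q = invmx Q *m N.
  by rewrite -[N in RHS](mulmxK uQ) hQ !mulmxA mulVmx // mul1mx.
have hs : ((mu i).-1 < part i)%N by rewrite munu; lia.
have := centralizer_below hab ha hb hV cb; rewrite mulmxK //.
move/(_ (Ordinal (pos_lt hs))); rewrite /a /= blk_pos // off_pos // /d eqxx.
rewrite subn1 leqnn mxE /= off_pos // blk_pos // prednK // eqxx.
by move/(_ isT)/eqP; rewrite oner_eq0.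
Qed.

(** The indices at which a generic vector can be normalised: one leading index
    in each maximal block, at which the vector has a nonzero end coordinate, and
    a retraction rho of the indices of positive mu onto the leading ones that
    goes up in the order of [maximal]. *)
Lemma leading_indices (c : 'rV[K]_n) : generic c ->
  exists (lead : pred nat) (rho : nat -> nat),
  [/\ forall i, (0 < mu i)%N ->
        [/\ lead (rho i), (mu i <= mu (rho i))%N & (nu (rho i) <= nu i)%N],
      forall i, lead i -> rho i = i,
      forall i, lead i -> (0 < mu i)%N &
      forall r : 'I_n, lead (blk r) -> (off r).+1 = mu (blk r) -> c 0 r != 0].
Proof.
case=> cb cmax.
pose end_nz i := [exists r : 'I_n,
  [&& blk r == i, (off r).+1 == mu i & c 0 r != 0]].
pose P l i := [&& part i == l, (0 < mu i)%N & end_nz i].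
pose rep l : nat := if [pick i : 'I_(size lam) | P l i] is Some i then val i else 0%N.
have repP i : maximal i -> P (part i) (rep (part i)).
  move=> mi; have [|r [h1 h2 h3]] := cmax i _ mi.
    by apply: mu_gt0_lt; case/andP: mi.
  rewrite /rep; case: pickP => // /(_ (Ordinal (blk_lt (ltn_ord r)))).
  rewrite /P /= h1 eqxx -h2 /=; case/existsP; exists r.
  by rewrite eqxx h2 eqxx.
pose up i t := [&& maximal t, (mu i <= mu t)%N & (nu t <= nu i)%N].
pose top i : nat := if [pick t : 'I_(size lam) | up i t] is Some t then val t else 0%N.
have topP i : (0 < mu i)%N -> up i (top i).
  move=> /maximal_above[t [h1 h2 h3]]; rewrite /top; case: pickP => // no.
  have mt : (0 < mu t)%N by case/andP: h1.
  by have := no (Ordinal (mu_gt0_lt mt)); rewrite /up /= h1 h2 h3.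
have part_nu i i' : part i = part i' -> nu i = nu i'.
  by move=> e; have := part_mu e; have := munu i; have := munu i'; lia.
have maxE i i' : part i = part i' -> maximal i = maximal i'.
  by move=> e; rewrite /maximal e (part_mu e) (part_nu _ _ e).
exists (fun i => maximal i && (rep (part i) == i)), (fun i => rep (part (top i))).
split=> [i|i|i|r].
- move=> /topP/and3P[h1 h2 h3]; have /and3P[/eqP e _ _] := repP _ h1.
  by rewrite (maxE _ _ e) h1 e eqxx (part_mu e) (part_nu _ _ e).
- case/andP=> mi /eqP e; have mu0 : (0 < mu i)%N by case/andP: mi.
  have /and3P[h1 h2 h3] := topP _ mu0; rewrite -[RHS]e; congr rep.
  by apply: maximalP => //; apply: mu_gt0_lt; case/andP: h1.
- by case/andP=> mi _; case/andP: mi.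
case/andP=> mi /eqP e er; have /and3P[_ _ /existsP[s]] := repP _ mi.
rewrite e => /and3P[/eqP h1 /eqP h2 nz]; suff -> : r = s by [].
apply: val_inj; rewrite -[LHS](posK lam) -[RHS](posK lam) h1; congr pos.
by apply/succn_inj; rewrite er h2.
Qed.

Section Normalisation.
Variables (c : 'rV[K]_n) (lead : pred nat) (rho : nat -> nat).
Hypothesis c_below : below mu c.
Hypothesis rhoP : forall i, (0 < mu i)%N ->
  [/\ lead (rho i), (mu i <= mu (rho i))%N & (nu (rho i) <= nu i)%N].
Hypothesis rho_id : forall i, lead i -> rho i = i.
Hypothesis lead_gt0 : forall i, lead i -> (0 < mu i)%N.
Hypothesis lead_nz : forall r : 'I_n,
  lead (blk r) -> (off r).+1 = mu (blk r) -> c 0 r != 0.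

(** What the leading chains must contribute to [c] once every other chain is
    kept as it is. *)
Definition lead_part : 'rV[K]_n :=
  \row_r (c 0 r - (((off r).+1 == mu (blk r)) && ~~ lead (blk r))%:R).

(** Tops of the new chains. The new chain of a leading index i takes over the
    coordinates of [lead_part] in all blocks that rho sends to i, raised by
    nu i steps, so that nu i steps down from its top they are back in place.
    The inequalities on rho make this possible: there is room for nu i more
    steps, and the raised vector still dies after lambda_i steps. *)
Definition new_top (i : nat) : 'rV[K]_n :=
  if lead i then
    \sum_(r < n | (rho (blk r) == i) && (off r < mu (blk r))%N)
      lead_part 0 r *: E (pos (blk r) (off r + nu i))
  else E (pos i (part i).-1).

Lemma new_top_lead i a : lead i -> new_top i *m N ^+ a =
    \sum_(r < n | (rho (blk r) == i) && (off r < mu (blk r))%N)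
      lead_part 0 r *: (if (a <= off r + nu i)%N then
         E (pos (blk r) (off r + nu i - a)) else 0).
Proof.
move=> hi; rewrite /new_top hi mulmx_suml; apply: eq_bigr => r /andP[/eqP h1 h2].
rewrite -scalemxAl unit_row_jordanX_pos // munu.
have [|_ h3 h4] := rhoP (i := blk r); first by lia.
by move: h4; rewrite h1; lia.
Qed.

Lemma new_top_other i a : ~~ lead i -> (a < part i)%N ->
  new_top i *m N ^+ a = E (pos i ((part i).-1 - a)).
Proof.
move=> hi h2; rewrite /new_top (negbTE hi) unit_row_jordanX_pos; last by lia.
by rewrite ifT //; lia.
Qed.

Lemma new_top_ker i : (0 < part i)%N -> new_top i *m N ^+ part i = 0.
Proof.
move=> hi; have [hl|hl] := boolP (lead i); last first.
  rewrite /new_top (negbTE hl).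
  by rewrite unit_row_jordanX_pos ?ifF //; lia.
rewrite new_top_lead // big1 // => r /andP[/eqP h1 h2].
have [|_ h3 h4] := rhoP (i := blk r); first by lia.
rewrite ifF ?scaler0 //; move: h3; rewrite h1.
by have := munu i; lia.
Qed.

(** Going down nu_i steps from its top, a new leading chain reaches the part of
    [lead_part] that it took over, while an old chain i reaches v_(i, mu_i). *)
Lemma new_top_sum :
  \sum_(i < size lam) (if (0 < mu i)%N then new_top i *m N ^+ nu i else 0) = c.
Proof.
rewrite (bigID (fun i : 'I__ => lead i)) /=.
have -> : \sum_(i < size lam | lead i)
    (if (0 < mu i)%N then new_top i *m N ^+ nu i else 0) = lead_part.
  rewrite (eq_bigr (fun i : 'I__ => \sum_(r < n | (rho (blk r) == i) &&
      (off r < mu (blk r))%N) lead_part 0 r *: E r)); last first.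
    move=> i hi; rewrite lead_gt0 // new_top_lead //.
    by apply: eq_bigr => r _; rewrite leq_addl addnK posK.
  rewrite [RHS]row_unit_row (bigID (fun r : 'I_n => (off r < mu (blk r))%N)) /=.
  rewrite [X in _ = _ + X]big1 ?addr0; last first.
    move=> r; rewrite -leqNgt => h; rewrite mxE c_below // sub0r.
    by rewrite gtn_eqF ?oppr0 ?scale0r // ltnS.
  have rho_lt (r : 'I_n) : (off r < mu (blk r))%N -> (rho (blk r) < size lam)%N.
    move=> h; have [|/lead_gt0 h1 _ _] := rhoP (i := blk r); first by lia.
    exact: mu_gt0_lt.
  rewrite (exchange_big_dep (fun r : 'I_n => (off r < mu (blk r))%N)) /=; last first.
    by move=> i r _ /andP[].
  apply: eq_bigr => r h; rewrite (big_pred1 (Ordinal (rho_lt r h))) // => i.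
  rewrite h andbT /= -val_eqE /= eq_sym andbC.
  case: eqP => //= ->.
  by have [|-> _ _] := rhoP (i := blk r); first by lia.
have -> : \sum_(i < size lam | ~~ lead i)
      (if (0 < mu i)%N then new_top i *m N ^+ nu i else 0) =
    \sum_(i < size lam) \sum_(j < part i)
      (j.+1 == mu i)%:R *: ((~~ lead i)%:R *: E (pos i j)).
  rewrite big_mkcond; apply: eq_bigr => i _.
  rewrite (sum_pick (fun j => (~~ lead i)%:R *: E (pos i j))); last first.
    by rewrite munu leq_addr.
  have [hi|hi] := boolP (lead i); first by rewrite /= scale0r if_same.
  case: posnP => // m0; rewrite new_top_other ?scale1r //.
  - by congr (E (pos _ _)); rewrite munu; lia.
  - by rewrite munu; lia.
rewrite -(big_positions _ _ (fun i j =>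
  (j.+1 == mu i)%:R *: ((~~ lead i)%:R *: E (pos i j)))).
apply/rowP=> s; rewrite [LHS]mxE [lead_part 0 s]mxE.
rewrite summxE (bigD1 s) //= big1 ?addr0 => [|r rs].
  by rewrite posK !mxE eqxx mulr1 -natrM mulnb subrK.
rewrite posK !mxE; case: (s =P r :> nat) => [/val_inj e|_]; last by rewrite !mulr0.
by rewrite e eqxx in rs.
Qed.

Local Notation Q := (chain_mx N new_top).

Lemma std_vec_chain : std_vec *m Q = c.
Proof.
rewrite -[RHS]new_top_sum mulmx_sum_row.
rewrite (eq_bigr (fun r : 'I_n => (fun i j => (j.+1 == mu i)%:R *:
    (new_top i *m N ^+ (part i - j.+1))) (blk r) (off r))); last first.
  move=> r _; rewrite mxE -unit_row_mul -[in E r](posK lam r).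
  by rewrite chain_mxE // off_lt.
rewrite (big_positions _ _ (fun i j => (j.+1 == mu i)%:R *:
    (new_top i *m N ^+ (part i - j.+1)))).
apply: eq_bigr => i _.
rewrite (sum_pick (fun j => new_top i *m N ^+ (part i - j.+1))); last first.
  by rewrite munu leq_addr.
by case: posnP => // m0; rewrite prednK // munu addKn.
Qed.

Lemma new_bottom (r s : 'I_n) : off r = 0%N ->
  Q r s = (new_top (blk r) *m N ^+ (part (blk r) - 1)) 0 s.
Proof.
move=> r0; have := @chain_mxE K lam N new_top _ _ (off_lt (ltn_ord r)).
by rewrite posK r0 unit_row_mul => <-; rewrite [RHS]mxE.
Qed.

Lemma new_bottom_other (r s : 'I_n) : off r = 0%N -> ~~ lead (blk r) ->
  Q r s = (r == s)%:R.
Proof.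
move=> r0 hr; have hp := off_lt (ltn_ord r).
rewrite new_bottom // new_top_other //; last by lia.
have -> : ((part (blk r)).-1 - (part (blk r) - 1) = off r)%N by lia.
by rewrite posK mxE eq_sym.
Qed.

(** A leading chain s is its own image under rho, so among the leading chains
    only the new chain of s involves chain s; the other chains are unchanged. *)
Lemma new_bottom_lead (r s : 'I_n) : off r = 0%N -> off s = 0%N ->
  lead (blk s) -> (Q r s == 0) = (r != s).
Proof.
move=> r0 s0 hs; have [->|rs] := eqVneq r s; last first.
  have [hr|hr] := boolP (lead (blk r)); last first.
    by rewrite new_bottom_other // (negbTE rs) eqxx.
  rewrite new_bottom // new_top_lead // summxE big1 ?eqxx // => t /andP[/eqP h1 h2].
  have [|_ h4 h5] := rhoP (i := blk t); first by lia.
  rewrite [LHS]mxE; case: ifP => [h6|]; last by rewrite [X in _ * X]mxE mulr0.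
  rewrite [X in _ * X]mxE; case: eqP => [e|]; last by rewrite mulr0.
  have ht : (off t + nu (blk r) - (part (blk r) - 1) < part (blk t))%N.
    by move: h5; rewrite h1 !munu; lia.
  have bt : blk t = blk s by rewrite e blk_pos.
  case/eqP: rs; apply: val_inj; rewrite -[LHS](posK lam) -[RHS](posK lam).
  by rewrite s0 r0 -h1 bt rho_id.
have m0 := lead_gt0 hs.
have hm : ((mu (blk s)).-1 < part (blk s))%N by rewrite munu; lia.
pose t0 : 'I_n := Ordinal (pos_lt hm).
have b0 : blk t0 = blk s by rewrite /t0 /= blk_pos.
have o0 : off t0 = (mu (blk s)).-1 by rewrite /t0 /= off_pos.
rewrite new_bottom // new_top_lead // summxE (bigD1 t0) /=; last first.
  by rewrite b0 o0 rho_id // eqxx; lia.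
rewrite big1 ?addr0 => [|t /andP[/andP[/eqP h1 h2] h3]].
  have -> : off (pos (blk s) (mu (blk s)).-1) = (mu (blk s)).-1 by rewrite off_pos.
  have -> : blk (pos (blk s) (mu (blk s)).-1) = blk s by rewrite blk_pos.
  rewrite munu ifT; last by lia.
  have -> : ((mu (blk s)).-1 + nu (blk s) - (mu (blk s) + nu (blk s) - 1) = off s)%N.
    by lia.
  rewrite posK !mxE eqxx mulr1 b0 hs andbF subr0; apply/negbTE/lead_nz.
    by rewrite b0.
  by rewrite b0 o0 prednK.
have [|_ h4 h5] := rhoP (i := blk t); first by lia.
rewrite [LHS]mxE; case: ifP => [h6|]; last by rewrite [X in _ * X]mxE mulr0.
rewrite [X in _ * X]mxE; case: eqP => [e|]; last by rewrite mulr0.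
have ht : (off t + nu (blk s) - (part (blk s) - 1) < part (blk t))%N.
  by move: h5; rewrite h1 !munu; lia.
have bt : blk t = blk s by rewrite e blk_pos.
have ot : off t = (mu (blk s)).-1 by move: h2 h6; rewrite bt munu; lia.
by case/eqP: h3; apply: val_inj; rewrite -[LHS](posK lam) bt ot.
Qed.

(** A relation between the new bottoms has coefficient 0 at each leading index
    by [new_bottom_lead], and the other bottoms have not changed. *)
Lemma new_chain_unitmx : Q \in unitmx.
Proof.
apply: (jordan_unitmx (chain_mx_comm new_top_ker)) => z zN zQ.
have z0 (r : 'I_n) : (0 < off r)%N -> z 0 r = 0.
  by apply/(@jordan_kerP K lam z 1); rewrite expr1 zN.
have zQs (s : 'I_n) : off s = 0%N ->
    (forall r : 'I_n, off r = 0%N -> r != s -> z 0 r * Q r s = 0) ->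
    z 0 s * Q s s = 0.
  move=> s0 h; have := congr1 (fun u : 'rV_n => u 0 s) zQ.
  rewrite [LHS]mxE [RHS]mxE (bigD1 s) //= big1 ?addr0 // => r rs.
  by have [/h->//|/z0->] := posnP (off r); rewrite mul0r.
have z_lead (s : 'I_n) : lead (blk s) -> z 0 s = 0.
  move=> hs; have [s0|/z0//] := posnP (off s).
  have /eqP : z 0 s * Q s s = 0.
    apply: zQs => // r r0 rs.
    by have /eqP -> : Q r s == 0; rewrite ?mulr0 // new_bottom_lead.
  by rewrite mulf_eq0 new_bottom_lead // eqxx orbF => /eqP.
apply/rowP=> s; rewrite [RHS]mxE; have [s0|/z0//] := posnP (off s).
have [/z_lead //|hs] := boolP (lead (blk s)).
have := zQs s s0; rewrite new_bottom_other // eqxx mulr1; apply=> r r0 rs.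
have [/z_lead->|hr] := boolP (lead (blk r)); first by rewrite mul0r.
by rewrite new_bottom_other // (negbTE rs) mulr0.
Qed.

End Normalisation.

(** A basis adapted to [c]: keep the chains of all indices that are not leading,
    and let the leading chains absorb the rest of [c]. *)
Lemma orbit_generic (c : 'rV[K]_n) : generic c ->
  exists Q : 'M[K]_n, [/\ Q \in unitmx, N *m Q = Q *m N & c = std_vec *m Q].
Proof.
move=> gc; have [lead [rho [h1 h2 h3 h4]]] := leading_indices gc.
exists (chain_mx N (new_top c lead rho)); split.
- exact: new_chain_unitmx h4.
- by apply: chain_mx_comm; exact: new_top_ker.
- by rewrite std_vec_chain //; case: gc.
Qed.

End Bipartition.
End Transitivity.

(** * Counting Jordan bases over a finite field *)
Section CountTops.
Variables (F : finFieldType) (n : nat).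
Local Notation q := #|F|.

Lemma card_rows_ker p (A : 'M[F]_(n, p)) :
  #|[set w : 'rV_n | w *m A == 0]| = (q ^ (n - \rank A))%N.
Proof.
by rewrite -mxrank_ker -card_rowg; apply: eq_card => w; rewrite !inE sub_kermx.
Qed.

(** The preimage of U under A is the kernel of A *m cokermx U. *)
Lemma card_rows_preim p t (A : 'M[F]_(n, p)) (U : 'M_(t, p)) : (U <= A)%MS ->
  #|[set w : 'rV_n | (w *m A <= U)%MS]| = (q ^ (n - \rank A + \rank U))%N.
Proof.
move=> UA; transitivity #|[set w : 'rV_n | w *m (A *m cokermx U) == 0]|.
  by apply: eq_card => w; rewrite !inE submxE -mulmxA.
rewrite card_rows_ker; congr (_ ^ _)%N.
have := mxrank_mul_ker A (cokermx U).
have -> : \rank (A :&: kermx (cokermx U))%MS = \rank U.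
  apply/eqP; rewrite eqn_leq !mxrankS //.
    by rewrite sub_capmx UA sub_kermx mulmx_coker eqxx.
  by rewrite (submx_trans (capmxSr _ _)) // submxE mulmx_ker.
have := rank_leq_row A => /[swap] <-.
by move: (\rank _) (\rank U) => a b; lia.
Qed.

Lemma row_free_col_mx t (B : 'M[F]_(t, n)) (b : 'rV_n) :
  row_free (col_mx B b) = row_free B && ~~ (b <= B)%MS.
Proof.
rewrite /row_free -addsmxE.
have [bB|nbB] := boolP (b <= B)%MS.
  rewrite (addsmx_idPl bB) andbF; apply/negbTE.
  by have := rank_leq_row B; lia.
have h1 : (\rank B < \rank (B + b)%MS)%N.
  by apply: rank_ltmx; rewrite ltmxE addsmxSl addsmx_sub submx_refl.
have h2 := mxrank_adds_leqif B b; have h3 := rank_leq_row b.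
by have := rank_leq_row B; have := h2.1; lia.
Qed.

Lemma card_supported (Z : {set 'I_n}) :
  #|[set c : 'rV[F]_n | [forall r in Z, c 0 r == 0]]| = (q ^ (n - #|Z|))%N.
Proof.
have -> : (n - #|Z| = #|~: Z|)%N by rewrite [RHS]cardsCs setCK card_ord.
rewrite -(card_pffun_on 0).
rewrite -[RHS](@card_imset _ _ (fun f : {ffun 'I_n -> F} => \row_r f r)); last first.
  by move=> f g /rowP e; apply/ffunP=> r; have := e r; rewrite !mxE.
apply: eq_card => c; apply/idP/imsetP; rewrite inE; last first.
  case=> f /pffun_onP[/subsetP h _] ->; apply/forall_inP=> r hr.
  by rewrite mxE; apply: contraTT hr => /h; rewrite inE.
move/forall_inP=> h; exists [ffun r => c 0 r]; last by apply/rowP=> r; rewrite mxE ffunE.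
apply/pffun_onP; split; last by move=> x _.
apply/subsetP=> r; rewrite !inE ffunE; apply: contraNN; exact: h.
Qed.

Variables (y : 'M[F]_n) (part : nat -> nat).
Hypothesis part_dec : {homo part : i j / (i <= j)%N >-> (j <= i)%N}.

(** A Jordan basis for y is determined by the tops of its chains. Conversely,
    vectors w_i killed by y^(part i) are the tops of independent chains exactly
    when the bottoms w_i y^(part i - 1) are independent. *)
Definition bottoms t (W : 'M[F]_(t, n)) : 'M[F]_(t, n) :=
  \matrix_i (row i W *m y ^+ (part i).-1).

Definition tops t : {set 'M[F]_(t, n)} :=
  [set W | [forall i, row i W *m y ^+ part i == 0] & row_free (bottoms W)].

Local Notation kerdim a := (n - \rank (y ^+ a))%N.

Lemma bottoms_col_mx t (W : 'M[F]_(t, n)) (w : 'rV_n) :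
  bottoms (col_mx W w) = col_mx (bottoms W) (w *m y ^+ (part t).-1).
Proof.
apply/row_matrixP=> i; rewrite rowK.
case: (split_ordP i) => j ->; first by rewrite !rowKu rowK.
by rewrite !rowKd !ord1 !row_id /= addn0.
Qed.

Lemma tops_col_mx t (W : 'M[F]_(t, n)) (w : 'rV_n) :
  (col_mx W w \in tops (t + 1)) = (W \in tops t) &&
    ((w *m y ^+ part t == 0) && ~~ (w *m y ^+ (part t).-1 <= bottoms W)%MS).
Proof.
rewrite !inE bottoms_col_mx.
have -> : row_free (col_mx (bottoms W) (w *m y ^+ (part t).-1)) =
    row_free (bottoms W) && ~~ (w *m y ^+ (part t).-1 <= bottoms W)%MS.
  exact: row_free_col_mx.
have -> : [forall i, row i (col_mx W w) *m y ^+ part i == 0] =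
    [forall i, row i W *m y ^+ part i == 0] && (w *m y ^+ part t == 0).
  apply/forallP/andP => [h|[/forallP h1 h2] i].
    split; last by have := h (rshift t ord0); rewrite rowKd row_id /= addn0.
    by apply/forallP=> i; have := h (lshift 1 i); rewrite rowKu.
  case: (split_ordP i) => j ->; first by rewrite rowKu h1.
  by rewrite rowKd ord1 row_id /= addn0.
by rewrite !andbA; congr (_ && _); rewrite -!andbA; congr (_ && _); rewrite andbC.
Qed.

(** Since the parts decrease, the bottoms already chosen lie in the image of
    y^(part t - 1), so they span a space whose preimage under that power has
    dimension kerdim (part t - 1) + t. The next top has to avoid it. *)
Lemma card_tops_step t : (0 < part t)%N -> 
  #|tops (t + 1)| =
  (#|tops t| * (q ^ kerdim (part t) - q ^ (kerdim (part t).-1 + t)))%N.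
Proof.
move=> pt; rewrite -sum1_card.
rewrite (reindex (fun p : 'M[F]_(t, n) * 'rV[F]_n => col_mx p.1 p.2)) /=; last first.
  exists (fun X => (usubmx X, dsubmx X)) => [[W w]|X] _ /=.
    by rewrite col_mxKu col_mxKd.
  by rewrite vsubmxK.
rewrite (eq_bigl (fun p : 'M[F]_(t, n) * 'rV[F]_n => (p.1 \in tops t) &&
  ((p.2 *m y ^+ part t == 0) &&
    ~~ (p.2 *m y ^+ (part t).-1 <= bottoms p.1)%MS))); last first.
  by move=> p; rewrite tops_col_mx.
rewrite -(pair_big_dep (fun W => W \in tops t) (fun W w => (w *m y ^+ part t == 0) &&
    ~~ (w *m y ^+ (part t).-1 <= bottoms W)%MS) (fun _ _ => 1%N)) /=.
rewrite -sum_nat_const; apply: eq_bigr => W; rewrite inE => /andP[/forallP ker fr].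
rewrite sum1dep_card -card_rows_ker.
have rB : \rank (bottoms W) = t by apply/eqP.
have BA : (bottoms W <= y ^+ (part t).-1)%MS.
  apply/row_subP=> i; rewrite rowK.
  have -> : ((part i).-1 = (part i - part t) + (part t).-1)%N.
    by have := part_dec (ltnW (ltn_ord i)); lia.
  by rewrite exprD -mulmxE mulmxA submxMl.
have By : bottoms W *m y = 0.
  apply/row_matrixP=> i; rewrite row_mul rowK row0 -mulmxA mulmxE -exprSr.
  have := part_dec (ltnW (ltn_ord i)); case: (part i) (eqP (ker i)) => [|p] //=.
  by lia.
have := card_rows_preim BA; rewrite rB => <-; rewrite -cardsDS.
  by apply: eq_card => w; rewrite !inE andbC.
apply/subsetP=> w; rewrite !inE => /submxP[D e].
by rewrite -(prednK pt) exprSr -mulmxE mulmxA e -mulmxA By mulmx0.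
Qed.

Lemma card_tops t : (forall i, (i < t)%N -> (0 < part i)%N) ->
  #|tops t| =
  (\prod_(i < t) (q ^ kerdim (part i) - q ^ (kerdim (part i).-1 + i)))%N.
Proof.
elim: t => [|t IHt] ht.
  rewrite big_ord0 -[RHS](cards1 (0 : 'M[F]_(0, n))); apply: eq_card => W.
  rewrite !inE [W]flatmx0 eqxx; apply/andP; split; first by apply/forallP; case.
  by rewrite /row_free [bottoms _]flatmx0 mxrank0.
rewrite big_ord_recr /= -IHt; last by move=> i hi; apply/ht/ltnW.
by rewrite -card_tops_step ?ht // addn1.
Qed.

End CountTops.

Section Intertwiners.
Variables (F : finFieldType) (lam : seq nat).
Local Notation q := #|F|.
Local Notation n := (sumn lam).
Local Notation part := (nth 0%N lam).
Local Notation blk := (blk lam).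
Local Notation off := (off lam).
Local Notation pos := (pos lam).
Local Notation E := (unit_row F n).
Local Notation N := (jordan_mx F lam).
Hypothesis part_dec : {homo part : i j / (i <= j)%N >-> (j <= i)%N}.
Hypothesis part_gt0 : forall i, (i < size lam)%N -> (0 < part i)%N.

Definition intertwiners (y : 'M[F]_n) : {set 'M[F]_n} :=
  [set Q in unitmx | N *m Q == Q *m y].

(** The dimension of the kernel of N^a. *)
Definition kerdim (a : nat) : nat := #|[set r : 'I_n | (off r < a)%N]|.

Lemma rank_jordanX a : (n - \rank (N ^+ a) = kerdim a)%N.
Proof.
have q1 : (1 < q)%N := card_finNzRing_gt1 F.
have := card_rows_ker (N ^+ a).
rewrite (eq_card (B := [set c : 'rV[F]_n |
  [forall r in [set r : 'I_n | (a <= off r)%N], c 0 r == 0]])); last first.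
  move=> c; rewrite !inE; apply/jordan_kerP/forall_inP => h r.
    by rewrite inE => /h ->.
  by move=> hr; apply/eqP/h; rewrite inE.
rewrite card_supported => /eqP; rewrite eqn_exp2l // => /eqP <-.
rewrite /kerdim -[X in (X - _)%N](card_ord n).
rewrite -(cardsC [set r : 'I_n | (a <= off r)%N]) addKn.
by apply: eq_card => r; rewrite !inE ltnNge.
Qed.

Section Fixed.
Variable y : 'M[F]_n.

Lemma pos_bottom (i : 'I_(size lam)) : (pos i 0 < n)%N.
Proof. by apply: pos_lt; exact: part_gt0. Qed.

Definition bottom_ord i : 'I_n := Ordinal (pos_bottom i).

Lemma bottoms_rowsub (Q : 'M[F]_n) (W : 'M[F]_(size lam, n)) : N *m Q = Q *m y ->
  (forall i : 'I_(size lam), row i W = E (pos i (part i).-1) *m Q) ->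
  bottoms y part W = rowsub bottom_ord Q.
Proof.
move=> hQ hW; apply/row_matrixP=> i; rewrite rowK hW row_rowsub.
rewrite -unit_row_mul /= (jordan_row_top hQ (part_gt0 (ltn_ord i))).
by rewrite subn1.
Qed.

Lemma unitmx_bottoms (Q : 'M[F]_n) : N *m Q = Q *m y ->
  (Q \in unitmx) = row_free (rowsub bottom_ord Q).
Proof.
move=> hQ; apply/idP/idP => [uQ|fr].
  apply: inj_row_free => z zQ.
  pose u : 'rV_n := \sum_i z 0 i *: E (bottom_ord i).
  have uQ0 : u *m Q = 0.
    rewrite -zQ mulmx_suml mulmx_sum_row; apply: eq_bigr => i _.
    by rewrite -scalemxAl unit_row_mul row_rowsub.
  have u0 : u = 0 by rewrite -(mulmxK uQ u) uQ0 mul0mx.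
  apply/rowP=> i; have := congr1 (fun v : 'rV_n => v 0 (bottom_ord i)) u0.
  rewrite summxE (bigD1 i) //= !mxE eqxx mulr1 big1 ?addr0 // => j ji.
  rewrite !mxE /=; case: eqP => [e|]; last by rewrite mulr0.
  have [e1 _] := pos_inj (part_gt0 (ltn_ord i)) (part_gt0 (ltn_ord j)) e.
  by case/eqP: ji; apply/val_inj.
apply: (jordan_unitmx hQ) => z zN zQ.
have z0 (r : 'I_n) : (0 < off r)%N -> z 0 r = 0.
  by apply/(@jordan_kerP F lam z 1); rewrite expr1 zN.
pose u : 'rV_(size lam) := \row_i z 0 (bottom_ord i).
suff u0 : u = 0.
  apply/rowP=> r; rewrite mxE; have [r0|/z0//] := posnP (off r).
  have := congr1 (fun v : 'rV_(size lam) => v 0 (Ordinal (blk_lt (ltn_ord r)))) u0.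
  rewrite !mxE => <-; congr (z 0 _); apply: val_inj => /=.
  by rewrite -[LHS](posK lam) r0.
apply: (row_free_inj fr); rewrite mul0mx -zQ !mulmx_sum_row.
pose f i j := if j == 0%N then
  (if insub (pos i j) is Some r then z 0 r *: row r Q else 0) else 0.
rewrite [RHS](eq_bigr (fun r : 'I_n => f (blk r) (off r))); last first.
  move=> r _; rewrite /f posK valK; have [//|/z0->] := posnP (off r).
  by rewrite scale0r.
rewrite (big_positions _ _ f); apply: eq_bigr => i _.
rewrite (bigD1 (Ordinal (part_gt0 (ltn_ord i)))) //= big1 ?addr0.
  rewrite /f /= insubT ?pos_bottom // => h; rewrite mxE row_rowsub.
  have -> : bottom_ord i = Sub (pos i 0) h by exact: val_inj.
  by [].
by move=> [[|j] hj]; rewrite // /f.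
Qed.

(** The rows at the tops of the chains determine an intertwiner. *)
Lemma card_intertwiners : #|intertwiners y| = #|tops y part (size lam)|.
Proof.
pose h (Q : 'M[F]_n) : 'M[F]_(size lam, n) :=
  \matrix_i (E (pos i (part i).-1) *m Q).
pose g (W : 'M[F]_(size lam, n)) := chain_mx y (fun i => unit_row F (size lam) i *m W).
have hrow Q (i : 'I_(size lam)) : row i (h Q) = E (pos i (part i).-1) *m Q.
  by rewrite rowK.
have hg W : h (g W) = W.
  apply/row_matrixP=> i; rewrite hrow chain_mxE ?prednK ?part_gt0 //.
  by rewrite subnn expr0 mulmx1 unit_row_mul.
have gh Q : N *m Q = Q *m y -> g (h Q) = Q.
  move=> hQ; apply/row_matrixP=> r; rewrite -!unit_row_mul -(posK lam r).
  have hr := off_lt (ltn_ord r); rewrite chain_mxE // [RHS](jordan_row_top hQ) //.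
  rewrite -[X in unit_row _ _ X]/(val (Ordinal (blk_lt (ltn_ord r)))).
  by rewrite unit_row_mul hrow.
have gcomm W : (forall i, row i W *m y ^+ part i = 0) -> N *m g W = g W *m y.
  move=> hW; apply: chain_mx_comm => i hi.
  have hs : (i < size lam)%N by rewrite ltnNge; apply: contraTN hi => /(nth_default 0%N)->.
  by rewrite -[X in unit_row _ _ X]/(val (Ordinal hs)) unit_row_mul hW.
have inj : {in intertwiners y &, injective h}.
  move=> Q Q'; rewrite !inE => /andP[_ /eqP h1] /andP[_ /eqP h2] e.
  by rewrite -(gh _ h1) -(gh _ h2) e.
rewrite -(card_in_imset inj); apply: eq_card => W; apply/imsetP/idP.
  case=> Q; rewrite inE => /andP[uQ /eqP hQ] ->; rewrite inE.
  rewrite (bottoms_rowsub hQ (hrow Q)) -unitmx_bottoms // uQ andbT.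
  apply/forallP=> i; apply/eqP.
  by rewrite hrow; apply: jordan_row_top_ker => //; exact: part_gt0.
rewrite inE => /andP[/forallP ker fr].
have hgc : N *m g W = g W *m y by apply: gcomm => i; exact/eqP.
exists (g W); last by rewrite hg.
rewrite inE hgc eqxx andbT unitmx_bottoms //.
by rewrite -(@bottoms_rowsub _ W hgc) // => i; rewrite -hrow hg.
Qed.

(** The count sees only the ranks of the powers of y. *)
Lemma card_intertwiners_rank : (forall a, \rank (y ^+ a) = \rank (N ^+ a)) ->
  #|intertwiners y| = (\prod_(i < size lam)
    (q ^ kerdim (part i) - q ^ (kerdim (part i).-1 + i)))%N.
Proof.
move=> hy; rewrite card_intertwiners card_tops //.
by apply: eq_bigr => i _; rewrite !hy !rank_jordanX.
Qed.

End Fixed.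

(** Over a finite field the ranks of the powers of y detect its Jordan type: by
    [card_intertwiners_rank] y has as many Jordan bases as N, which has one. *)
Lemma intertwiner_exists (y : 'M[F]_n) :
  (forall a, \rank (y ^+ a) = \rank (N ^+ a)) ->
  exists2 Q : 'M[F]_n, Q \in unitmx & N *m Q = Q *m y.
Proof.
move=> hy; have : (0 < #|intertwiners N|)%N.
  by apply/card_gt0P; exists 1%:M; rewrite inE unitmx1 mulmx1 mul1mx eqxx.
rewrite card_intertwiners_rank // -(card_intertwiners_rank hy).
by case/card_gt0P=> Q; rewrite inE => /andP[uQ /eqP]; exists Q.
Qed.

End Intertwiners.

(** * The orbit in terms of row vectors *)
Lemma nth_padd mu nu i : nth 0%N (padd mu nu) i = (nth 0 mu i + nth 0 nu i)%N.
Proof.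
rewrite /padd; have [h|h] := ltnP i (maxn (size mu) (size nu)).
  by rewrite nth_mkseq.
by rewrite !nth_default ?size_mkseq //; move: h; rewrite geq_max => /andP[].
Qed.

Section OrbitRows.
Variables (K : fieldType) (lam : seq nat).
Local Notation n := (sumn lam).
Local Notation part := (nth 0%N lam).
Local Notation blk := (blk lam).
Local Notation off := (off lam).
Local Notation pos := (pos lam).
Local Notation E := (unit_row K n).
Local Notation N := (jordan_mx K lam).

Lemma trmxX (x : 'M[K]_n) a : (x ^+ a)^T = x^T ^+ a.
Proof.
elim: a => [|a IHa]; first by rewrite !expr0 trmx1.
by rewrite exprS -mulmxE trmx_mul IHa exprSr.
Qed.

Lemma chain_seqE (e : nat -> nat -> 'cV[K]_n) :
  [seq e i j | i <- iota 0 (size lam), j <- iota 1 (part i)] =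
  [seq e (blk r) (off r).+1 | r <- iota 0 n].
Proof.
rewrite (map_comp (fun p : nat * nat => e p.1 p.2.+1) (fun r => (blk r, off r))).
rewrite positionsE map_allpairs /=; congr flatten; apply: eq_map => i.
by rewrite (iotaDl 1 0) -map_comp.
Qed.

Lemma basis_unitmx (e : nat -> nat -> 'cV[K]_n) (Q : 'M[K]_n) :
  (forall r : 'I_n, row r Q = (e (blk r) (off r).+1)^T) ->
  basis_of {: 'cV[K]_n}%VS
    [seq e i j | i <- iota 0 (size lam), j <- iota 1 (part i)] = (Q \in unitmx).
Proof.
move=> hQ; rewrite chain_seqE basisEdim size_map size_iota dimvf dim_matrix.
rewrite [X in (_ <= X)%N](_ : _ = n) ?leqnn ?andbT; last by exact: muln1.
set X := [seq _ | r <- _].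
have nthX (r : 'I_n) : X`_r = (row r Q)^T.
  by rewrite hQ trmxK (nth_map 0%N) ?size_iota // nth_iota.
apply/subvP/idP => [hX|uQ w _].
  rewrite -row_full_unit -sub1mx; apply/row_subP => r.
  set u := row r _; have := hX u^T (memvf _).
  move/(@coord_span _ _ _ (in_tuple X))/(congr1 trmx); rewrite trmxK linear_sum => ->.
  apply: summx_sub => i _ /=; rewrite linearZ /= scalemx_sub //.
  have hi : (i < n)%N by have := ltn_ord i; rewrite {2}size_map size_iota.
  by rewrite (nthX (Ordinal hi)) trmxK row_sub.
rewrite -[w]trmxK -[w^T](mulmxKV uQ) mulmx_sum_row linear_sum.
apply: memv_suml => r _ /=; rewrite linearZ /= memvZ // -nthX memv_span //.
by rewrite mem_nth // size_map size_iota.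
Qed.

Lemma std_vec_sum (mu : nat -> nat) (e : nat -> nat -> 'cV[K]_n) (Q : 'M[K]_n) :
  (forall r : 'I_n, row r Q = (e (blk r) (off r).+1)^T) ->
  (forall i, (i < size lam)%N -> e i 0%N = 0) ->
  (forall i, (i < size lam)%N -> (mu i <= part i)%N) ->
  (\sum_(i < size lam) e i (mu i))^T = std_vec K lam mu *m Q.
Proof.
move=> hQ e0 hmu; rewrite mulmx_sum_row linear_sum /=.
rewrite [RHS](eq_bigr (fun r : 'I_n => (fun i j =>
   (j.+1 == mu i)%:R *: (e i j.+1)^T) (blk r) (off r))); last first.
  by move=> r _; rewrite mxE hQ.
rewrite (big_positions _ _ (fun i j => (j.+1 == mu i)%:R *: (e i j.+1)^T)).
apply: eq_bigr => i _; rewrite (sum_pick (fun j => (e i j.+1)^T)) ?hmu //.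
by case: posnP => [->|m0]; rewrite ?e0 ?trmx0 // prednK.
Qed.

End OrbitRows.

(** Row r of Q is the transpose of the basis vector in cell r. The transposition
    lets the row-space theory of matrices apply to the chains. *)
Lemma orbit_rowsP (K : fieldType) (mu nu : seq nat)
    (v : 'cV[K]_(sumn (padd mu nu))) (x : 'M[K]_(sumn (padd mu nu))) :
  let lam := padd mu nu in
  orbit_munu mu nu v x <->
  exists Q : 'M[K]_(sumn lam), [/\ Q \in unitmx,
    jordan_mx K lam *m Q = Q *m x^T &
    v^T = std_vec K lam (nth 0%N mu) *m Q].
Proof.
move=> lam; have mu_le i : (nth 0 mu i <= nth 0 lam i)%N by rewrite nth_padd leq_addr.
split=> [[_ [e [basis e0 ex] ->]]|[Q [uQ hQ hv]]].
  pose Q : 'M[K]_(sumn lam) := \matrix_r (e (blk lam r) (off lam r).+1)^T.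
  have hQ (r : 'I_(sumn lam)) : row r Q = (e (blk lam r) (off lam r).+1)^T.
    by rewrite rowK.
  have rowQ i j : (j < nth 0 lam i)%N ->
      unit_row K (sumn lam) (pos lam i j) *m Q = (e i j.+1)^T.
    move=> h; have hp := pos_lt h; rewrite -[pos lam i j]/(val (Ordinal hp)).
    by rewrite unit_row_mul hQ /= blk_pos // off_pos.
  have lt_size i j : (j < nth 0 lam i)%N -> (i < size lam)%N.
    by move=> h; rewrite ltnNge; apply: contraTN h => /(nth_default 0%N) ->.
  exists Q; split.
  - by rewrite -(basis_unitmx hQ).
  - apply: jordan_comm_row => i j h; rewrite rowQ // -trmx_mul ex ?h ?(lt_size _ _ h) //.
    case: j h => [|j] h /=; first by rewrite e0 ?trmx0 // (lt_size _ _ h).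
    by rewrite rowQ // ltnW.
  - by apply: std_vec_sum.
pose e i j : 'cV[K]_(sumn lam) := if j is j'.+1 then
  (unit_row K (sumn lam) (pos lam i j') *m Q)^T else 0.
have hE (r : 'I_(sumn lam)) : row r Q = (e (blk lam r) (off lam r).+1)^T.
  by rewrite /e posK unit_row_mul trmxK.
split.
  exists (sumn lam); apply: trmx_inj; rewrite trmxX trmx0.
  by rewrite -(mulKmx uQ (x^T ^+ _)) -jordan_commX // jordan_mx_nilpotent mul0mx mulmx0.
exists e.
  split=> //; first by rewrite (basis_unitmx hE).
  move=> i [|j] // _ h; apply: trmx_inj; rewrite trmx_mul /e /= trmxK -mulmxA -hQ.
  rewrite mulmxA -[jordan_mx _ _]expr1 unit_row_jordanX_pos //.
  by case: j {h} => [|j] /=; rewrite ?mul0mx ?trmx0 // subn1 trmxK.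
by apply: trmx_inj; rewrite hv; apply/esym/std_vec_sum.
Qed.

(** * Rational points *)
Lemma geq_trans : transitive geq.
Proof. by move=> a b c h1 h2; exact: leq_trans h2 h1. Qed.

Lemma geq_refl : reflexive geq.
Proof. exact: leqnn. Qed.

Lemma is_partition_dec lam : is_partition lam ->
  {homo nth 0%N lam : i j / (i <= j)%N >-> (j <= i)%N}.
Proof.
case/andP=> srt _ i j ij; have [h|h] := ltnP j (size lam); last first.
  by rewrite [X in (X <= _)%N]nth_default.
apply: (sorted_leq_nth geq_trans geq_refl 0%N srt) => //; rewrite inE //.
exact: leq_ltn_trans h.
Qed.

Lemma is_partition_gt0 lam i : is_partition lam -> (i < size lam)%N ->
  (0 < nth 0 lam i)%N.
Proof.
case/andP=> _ h hi; rewrite lt0n; apply: contraNN h => /eqP <-.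
exact: mem_nth.
Qed.

Section RationalPoints.
Variables (k : fieldType) (F : finFieldType) (iota : {rmorphism F -> k}).
Variables (mu nu : seq nat).
Local Notation lam := (padd mu nu).
Local Notation n := (sumn lam).
Local Notation part := (nth 0%N lam).
Local Notation fmu := (nth 0%N mu).
Local Notation fnu := (nth 0%N nu).
Hypotheses (muP : is_partition mu) (nuP : is_partition nu) (lamP : is_partition lam).
Local Notation N K := (jordan_mx K lam).
Local Notation std K := (std_vec K lam fmu).

Lemma map_jordan_mx : map_mx iota (N F) = N k.
Proof. by apply/matrixP=> r s; rewrite !mxE rmorph_nat. Qed.

Lemma map_std_vec : map_mx iota (std F) = std k.
Proof. by apply/matrixP=> r s; rewrite !mxE rmorph_nat. Qed.

Lemma map_mxX (y : 'M[F]_n) a : map_mx iota (y ^+ a) = map_mx iota y ^+ a.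
Proof. exact: rmorphXn. Qed.

Lemma generic_map (c : 'rV[F]_n) :
  generic fmu fnu (map_mx iota c) -> generic fmu fnu c.
Proof.
case=> h1 h2; split=> [r /h1/eqP|i hi /(h2 i hi)[r [e1 e2 nz]]].
  by rewrite mxE fmorph_eq0 => /eqP.
by exists r; split=> //; move: nz; rewrite mxE fmorph_eq0.
Qed.

(** A Jordan basis over k fixes the ranks of the powers of x, and hence gives a
    Jordan basis over F, in which v has coordinates c in F. Over k, c is in the
    centralizer orbit of the base vector, so it is generic; this is a condition on
    the vanishing of coordinates, so it also holds over F, where it can be used to
    move c to the base vector. *)
Lemma rational_orbitP (v : 'cV[F]_n) (x : 'M[F]_n) :
  orbit_munu mu nu (map_mx iota v) (map_mx iota x) <->
  exists Q : 'M[F]_n, [/\ Q \in unitmx, N F *m Q = Q *m x^T &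
    v^T = std F *m Q].
Proof.
have munu := nth_padd mu nu.
have mu_dec := is_partition_dec muP; have nu_dec := is_partition_dec nuP.
split=> [/orbit_rowsP[Qk]|[Q [uQ hQ hv]]]; last first.
  apply/orbit_rowsP; exists (map_mx iota Q); rewrite !map_trmx.
  split; first by rewrite map_unitmx.
    by rewrite -map_jordan_mx -!map_mxM hQ.
  by rewrite -map_std_vec -map_mxM hv.
rewrite !map_trmx => -[uQk hQk hvk].
have [|Q0 uQ0 hQ0] := @intertwiner_exists F lam (is_partition_dec lamP)
    (fun i => is_partition_gt0 lamP) x^T.
  move=> a; rewrite -(mxrank_map iota) -[RHS](mxrank_map iota) !map_mxX.
  by rewrite map_jordan_mx (jordan_rankX _ uQk hQk).
have uQ0k : map_mx iota Q0 \in unitmx by rewrite map_unitmx.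
pose c := v^T *m invmx Q0.
have gc : generic fmu fnu c.
  apply: generic_map; rewrite map_mxM map_invmx hvk -mulmxA.
  apply: generic_orbit => //.
    by rewrite unitmx_mul uQk unitmx_inv.
  have hQ0k : N k *m map_mx iota Q0 = map_mx iota Q0 *m map_mx iota x^T.
    by rewrite -map_jordan_mx -!map_mxM hQ0.
  exact: jordan_commV hQ0k hQk.
have [R [uR hR hc]] := orbit_generic munu mu_dec nu_dec gc.
exists (R *m Q0); split; first by rewrite unitmx_mul uR.
  by rewrite mulmxA hR -!mulmxA hQ0.
by rewrite mulmxA -hc mulmxKV.
Qed.

Definition generic_set : {set 'rV[F]_n} := [set c | `[< generic fmu fnu c >]].

(** The map (Q, c) |-> (c Q, Q^-1 N Q), with c generic, reaches exactly the points
    of the orbit, up to transposition. The fibre over (v, x) is the set of all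
    intertwiners from N to x^T: c is determined by Q, and is generic by
    [generic_orbit]. *)
Lemma card_orbit_points :
  (#|orbit_points iota n mu nu| * #|intertwiners (N F)| =
   #|[set Q : 'M[F]_n | Q \in unitmx]| * #|generic_set|)%N.
Proof.
have munu := nth_padd mu nu.
have mu_dec := is_partition_dec muP; have nu_dec := is_partition_dec nuP.
pose f (p : 'M[F]_n * 'rV[F]_n) : 'cV[F]_n * 'M[F]_n :=
  ((p.2 *m p.1)^T, (invmx p.1 *m N F *m p.1)^T).
rewrite -[RHS]cardsX -[RHS]sum1_card (partition_big f (mem (orbit_points iota n mu nu))) /=; last first.
  case=> Q c; rewrite !inE /= => /andP[uQ /asboolP gc]; apply/asboolP/rational_orbitP.
  have [R [uR hR hc]] := orbit_generic munu mu_dec nu_dec gc.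
  exists (R *m Q); split; first by rewrite unitmx_mul uR.
    by rewrite trmxK -mulmxA mulmxA hR !mulmxA mulmxK.
  by rewrite trmxK hc mulmxA.
rewrite -sum_nat_const; apply: eq_bigr => -[v x].
rewrite inE => /asboolP/rational_orbitP /= [Q0 [uQ0 hQ0 hv]].
rewrite sum1dep_card.
transitivity #|intertwiners x^T|.
  have rk a := jordan_rankX a uQ0 hQ0.
  have dec := is_partition_dec lamP.
  have gt0 i := @is_partition_gt0 _ i lamP.
  by rewrite !card_intertwiners_rank.
pose g (Q : 'M[F]_n) := (Q, v^T *m invmx Q).
rewrite -(card_imset _ (_ : injective g)); last by move=> Q Q' [].
apply: eq_card => -[Q c]; apply/imsetP/idP.
  case=> R; rewrite inE => /andP[uQ /eqP hQ] [-> ->] {Q c}; move: R uQ hQ => Q uQ hQ.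
  rewrite !inE uQ /= /f /= mulmxKV // trmxK.
  rewrite -mulmxA hQ mulKmx // trmxK eqxx andbT.
  apply/asboolP; rewrite hv -mulmxA; apply: generic_orbit => //.
    by rewrite unitmx_mul uQ0 unitmx_inv.
  exact: jordan_commV hQ hQ0.
rewrite !inE /= => /andP[/andP[uQ gc] /eqP[e1 e2]].
exists Q; last by rewrite /g -e1 trmxK mulmxK.
by rewrite inE uQ -e2 trmxK -(mulmxA (invmx Q)) mulKVmx /=.
Qed.

End RationalPoints.

(** * Counting generic vectors *)
Section CardGeneric.
Variable F : finFieldType.
Local Notation q := #|F|.

(** An invertible matrix is a family of tops of chains of length 1 for y = 0. *)
Lemma card_unitmx n :
  #|[set Q : 'M[F]_n | Q \in unitmx]| = (\prod_(i < n) (q ^ n - q ^ i))%N.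
Proof.
have one_dec : {homo (fun _ : nat => 1%N) : i j / (i <= j)%N >-> (j <= i)%N} by [].
transitivity #|tops (0 : 'M[F]_n) (fun _ => 1%N) n|.
  apply: eq_card => Q; rewrite !inE.
  have -> : bottoms (0 : 'M[F]_n) (fun _ => 1%N) Q = Q.
    by apply/row_matrixP=> i; rewrite rowK expr0 mulmx1.
  rewrite row_free_unit; case: (Q \in _); rewrite ?andbF // andbT.
  by apply/esym/forallP=> i; rewrite expr1 mulmx0.
rewrite card_tops //; apply: eq_bigr => i _.
by rewrite expr1 expr0 mxrank0 mxrank1 subn0 subnn.
Qed.

Section Blocks.
Variables (n : nat) (I : eqType) (B : I -> {set 'I_n}).
Local Notation Q := (q%:R : rat).

Definition nonzero_on (Z : {set 'I_n}) (s : seq I) : {set 'rV[F]_n} :=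
  [set c : 'rV[F]_n | [forall r in Z, c 0 r == 0] &
           all (fun h => [exists r in B h, c 0 r != 0]) s].

(** A block contributes the factor 1 - q^-|B h|: the vectors to discard are those
    which vanish on that block too, that is, with Z replaced by Z :|: B h. *)
Lemma card_nonzero_on (s : seq I) (Z : {set 'I_n}) : uniq s ->
  {in s &, forall h h', h != h' -> [disjoint B h & B h']} ->
  {in s, forall h, [disjoint Z & B h]} ->
  (#|nonzero_on Z s|%:R : rat) =
  Q ^+ (n - #|Z|) * \prod_(h <- s) (1 - Q^-1 ^+ #|B h|).
Proof.
have q0 : Q != 0 by rewrite pnatr_eq0 -lt0n; apply/card_gt0P; exists 0.
elim: s Z => [|h s IHs] Z /=.
  move=> _ _ _; rewrite big_nil mulr1 -natrX -card_supported; congr (_%:R).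
  by apply: eq_card => c; rewrite !inE andbT.
move=> /andP[hs us] dB dZ.
have dhs : {in s, forall h', [disjoint B h & B h']}.
  move=> h' h's; apply: dB; rewrite ?inE ?eqxx ?h's ?orbT //.
  by apply: contraNneq hs => ->.
have dZh : [disjoint Z & B h] by apply: dZ; rewrite inE eqxx.
have dB' : {in s &, forall h h', h != h' -> [disjoint B h & B h']}.
  by move=> a b ha hb; apply: dB; rewrite inE ?ha ?hb orbT.
have dZ' : {in s, forall h, [disjoint Z & B h]}.
  by move=> a ha; apply: dZ; rewrite inE ha orbT.
have dZB : {in s, forall a, [disjoint Z :|: B h & B a]}.
  move=> a ha; have := dZ' a ha; have := dhs a ha; rewrite !disjoints_subset => h1 h2.
  by rewrite subUset h2 h1.
have -> : nonzero_on Z (h :: s) = nonzero_on Z s :\: nonzero_on (Z :|: B h) s.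
  apply/setP=> c; rewrite !inE /=; case: (all _ s); rewrite ?andbF //= !andbT.
  have [hZ|hZ] := boolP [forall r in Z, c 0 r == 0]; rewrite ?andbF //= andbT.
  rewrite negb_forall; apply/existsP/existsP => -[r hr]; exists r; move: hr.
    by case/andP=> h1 h2; rewrite negb_imply inE h1 orbT.
  rewrite negb_imply inE => /andP[/orP[rZ|-> //]].
  by rewrite (forall_inP hZ r rZ).
have sub : nonzero_on (Z :|: B h) s \subset nonzero_on Z s.
  apply/subsetP=> c; rewrite !inE => /andP[/forall_inP h1 ->]; rewrite andbT.
  by apply/forall_inP=> r hr; apply: h1; rewrite inE hr.
have cU : #|Z :|: B h| = (#|Z| + #|B h|)%N.
  by apply/eqP; rewrite (leq_card_setU Z (B h)).2.
have hn : (#|Z| + #|B h| <= n)%N by rewrite -cU -[X in (_ <= X)%N]card_ord max_card.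
rewrite cardsDS // natrB ?subset_leq_card // !IHs // big_cons cU.
have -> : (n - #|Z| = (n - (#|Z| + #|B h|)) + #|B h|)%N by lia.
rewrite exprD exprVn; field.
by rewrite expf_neq0.
Qed.
End Blocks.

End CardGeneric.

Section Shape.
Variables (mu nu : seq nat).
Local Notation lam := (padd mu nu).
Local Notation n := (sumn lam).
Local Notation part := (nth 0%N lam).
Local Notation fmu := (nth 0%N mu).
Local Notation fnu := (nth 0%N nu).
Hypotheses (muP : is_partition mu) (nuP : is_partition nu) (lamP : is_partition lam).

Lemma dpart_lt h h' : (h < h')%N -> (h' < ndparts lam)%N ->
  (dpart lam h' < dpart lam h)%N.
Proof.
move=> hh' h'n; rewrite /dpart.
have srt : sorted geq (undup lam).
  by apply: (subseq_sorted geq_trans (undup_subseq _)); case/andP: lamP.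
have le : (nth 0 (undup lam) h' <= nth 0 (undup lam) h)%N.
  apply: (sorted_leq_nth geq_trans geq_refl 0%N srt) => //; rewrite ?inE //.
    exact: ltn_trans h'n.
  exact: ltnW.
rewrite ltn_neqAle le andbT nth_uniq ?undup_uniq //; last exact: ltn_trans h'n.
by rewrite gtn_eqF.
Qed.

Lemma dpart_index i : (i < size lam)%N ->
  exists2 h, (h < ndparts lam)%N & dpart lam h = part i.
Proof.
move=> hi; have pin : part i \in undup lam by rewrite mem_undup mem_nth.
by exists (index (part i) (undup lam)); rewrite ?index_mem // /dpart nth_index.
Qed.

Lemma dpart_mem h : (h < ndparts lam)%N ->
  (index (dpart lam h) lam < size lam)%N /\
  part (index (dpart lam h) lam) = dpart lam h.
Proof.
move=> hn; have hin : dpart lam h \in lam by rewrite -mem_undup mem_nth.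
by rewrite index_mem nth_index.
Qed.

Lemma dpart_inj h h' : (h < ndparts lam)%N -> (h' < ndparts lam)%N ->
  dpart lam h = dpart lam h' -> h = h'.
Proof.
move=> hn hn' e; case: (ltngtP h h') => // hh.
  by have := dpart_lt hh hn'; rewrite e ltnn.
by have := dpart_lt hh hn; rewrite e ltnn.
Qed.

Lemma part_le_munu a b : (part a <= part b)%N ->
  (fmu a <= fmu b)%N /\ (fnu a <= fnu b)%N.
Proof.
have := nth_padd mu nu a; have := nth_padd mu nu b.
have mu_dec := is_partition_dec muP; have nu_dec := is_partition_dec nuP.
case/orP: (leq_total a b) => ab; have := mu_dec _ _ ab; have := nu_dec _ _ ab; lia.
Qed.

(** In J only neighbouring blocks are compared. As mu and nu decrease, the next
    smaller part is the critical one for mu, and the next larger one for nu. *)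
Lemma in_Jset (h : 'I_(ndparts lam)) i : part i = dpart lam h ->
  (h \in Jset mu nu) = maximal lam fmu fnu i.
Proof.
move=> pi; have [ih_lt ihE] := dpart_mem (ltn_ord h).
have munu := nth_padd mu nu.
have mu_dec := is_partition_dec muP; have nu_dec := is_partition_dec nuP.
have bval (s : seq nat) g : (g < ndparts lam)%N ->
    block_val lam s g = nth 0%N s (index (dpart lam g) lam).
  by rewrite /block_val => ->.
have [mi ni] : fmu (index (dpart lam h) lam) = fmu i /\
    fnu (index (dpart lam h) lam) = fnu i.
  have [|h1 h2] := @part_le_munu i (index (dpart lam h) lam); first by rewrite pi ihE.
  have [|h3 h4] := @part_le_munu (index (dpart lam h) lam) i; first by rewrite pi ihE.
  by split; lia.
rewrite inE !(bval _ h) // mi ni.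
apply/andP/idP => [[hj hk]|maxi].
  rewrite /maximal (leq_ltn_trans _ hj) //=; apply/forallP=> i'.
  apply/implyP=> /andP[h1 h2]; rewrite pi; apply/eqP.
  have [h' h'n e'] := dpart_index (ltn_ord i'); rewrite -e'; congr dpart.
  case: (ltngtP h' h) => // hh.
    have h0 : (0 < h)%N by lia.
    move: hk; rewrite gtn_eqF //= bval; last exact: leq_ltn_trans (leq_pred _) (ltn_ord h).
    have hn1 : (h.-1 < ndparts lam)%N by exact: leq_ltn_trans (leq_pred _) (ltn_ord h).
    have [_ e1] := dpart_mem hn1.
    have [|_] := @part_le_munu (index (dpart lam h.-1) lam) i'; last by lia.
    rewrite e1 -e'; case: (ltngtP h' h.-1) => [hh1|hh1|->//]; last by lia.
    by have := dpart_lt hh1 hn1; lia.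
  have hn1 : (h.+1 < ndparts lam)%N by exact: leq_ltn_trans hh h'n.
  move: hj; rewrite bval //.
  have [_ e1] := dpart_mem hn1.
  have [|h3 _] := @part_le_munu i' (index (dpart lam h.+1) lam); last by lia.
  rewrite e1 -e'; case: (ltngtP h.+1 h') => [hh1|hh1|->//]; last by lia.
  by have := dpart_lt hh1 h'n; lia.
have mi0 : (0 < fmu i)%N by case/andP: maxi.
split.
  have [hn1|hn1] := ltnP h.+1 (ndparts lam); last by rewrite /block_val (ltnNge h.+1) hn1.
  rewrite bval //; have [e0 e1] := dpart_mem hn1.
  have lt := dpart_lt (ltnSn h) hn1.
  rewrite ltnNge; apply/negP=> le.
  have [|_ h3] := @part_le_munu (index (dpart lam h.+1) lam) i; first by lia.
  by have := maximalP maxi e0 le h3; lia.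
case: (posnP h) => [->//|h0]; apply/orP; right.
have hn1 : (h.-1 < ndparts lam)%N by exact: leq_ltn_trans (leq_pred _) (ltn_ord h).
rewrite bval //; have [e0 e1] := dpart_mem hn1.
have lt : (dpart lam h < dpart lam h.-1)%N by apply: dpart_lt => //; lia.
rewrite ltnNge; apply/negP=> le.
have [|h3 _] := @part_le_munu i (index (dpart lam h.-1) lam); first by lia.
by have := maximalP maxi e0 h3 le; lia.
Qed.

Lemma sum_nth (s : seq nat) m : (size s <= m)%N -> (\sum_(i < m) nth 0 s i = sumn s)%N.
Proof.
move=> h; rewrite sumnE (big_nth 0%N) big_mkord (big_ord_widen _ (nth 0%N s) h).
rewrite [RHS]big_mkcond; apply: eq_bigr => i _; case: ltnP => // h'.
by rewrite nth_default.
Qed.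

Definition upper_set : {set 'I_n} := [set r : 'I_n | (fmu (blk lam r) <= off lam r)%N].

Definition end_set (h : 'I_(ndparts lam)) : {set 'I_n} :=
  [set r : 'I_n | (part (blk lam r) == dpart lam h) &&
                  ((off lam r).+1 == fmu (blk lam r))].

Lemma card_upper_set : #|upper_set| = sumn nu.
Proof.
rewrite -sum1_card big_mkcond /=.
rewrite (eq_bigr (fun r : 'I_n => (fun i j => (fmu i <= j : nat)%N) (blk lam r) (off lam r)));
  last by move=> r _; rewrite inE; case: (_ <= _)%N.
rewrite (big_positions _ _ (fun i j => (fmu i <= j : nat)%N)).
rewrite -(@sum_nth nu (size lam)); last by rewrite size_mkseq leq_maxr.
apply: eq_bigr => i _; rewrite nth_padd big_split_ord /= big1 ?add0n => [|j _].
  rewrite (eq_bigr (fun=> 1%N)) => [|j _]; last by rewrite leq_addr.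
  by rewrite sum1_card card_ord.
by rewrite leqNgt ltn_ord.
Qed.

Lemma card_end_set h : h \in Jset mu nu -> #|end_set h| = mult lam h.
Proof.
move=> hJ; rewrite -sum1_card big_mkcond /=.
pose f i j : nat := (part i == dpart lam h) && (j.+1 == fmu i).
rewrite (eq_bigr (fun r : 'I_n => f (blk lam r) (off lam r))); last first.
  by move=> r _; rewrite inE /f; case: (_ && _).
rewrite big_positions /mult -sum1_count (big_nth 0%N) big_mkord [RHS]big_mkcond.
apply: eq_bigr => i _ /=; rewrite /f; case: eqP => [pi|_] /=; last by rewrite big1.
have : maximal lam fmu fnu i by rewrite -(in_Jset pi).
case/andP=> m0 _; have hm : ((fmu i).-1 < part i)%N by rewrite nth_padd; lia.
rewrite (bigD1 (Ordinal hm)) //= prednK // eqxx big1 // => j.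
by rewrite -val_eqE /= => hj; case: eqP => // e; case/eqP: hj; rewrite -e.
Qed.

Lemma card_generic_set (F : finFieldType) :
  (#|@generic_set F mu nu|%:R : rat) =
  #|F|%:R ^+ (n - sumn nu) *
  \prod_(h in Jset mu nu) (1 - #|F|%:R^-1 ^+ mult lam h).
Proof.
transitivity (#|nonzero_on F end_set upper_set (enum (Jset mu nu))|%:R : rat).
  congr (_%:R); apply: eq_card => c; rewrite !inE; apply/asboolP/andP.
    case=> h1 h2; split; first by apply/forall_inP=> r; rewrite inE => /h1 ->.
    apply/allP=> h; rewrite mem_enum => hJ; have [e0 e1] := dpart_mem (ltn_ord h).
    have [|r [r1 r2 r3]] := h2 _ e0; first by rewrite -(in_Jset e1).
    by apply/exists_inP; exists r; rewrite // inE r1 e1 r2 !eqxx.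
  case=> /forall_inP h1 /allP h2; split=> [r hr|i hi mi].
    by apply/eqP/h1; rewrite inE.
  have [h hn hE] := dpart_index hi.
  have hJ : Ordinal hn \in Jset mu nu by rewrite (@in_Jset _ i).
  have := h2 (Ordinal hn); rewrite mem_enum => /(_ hJ)/exists_inP[r].
  by rewrite inE => /andP[/eqP r1 /eqP r2] r3; exists r; rewrite r1 r2.
rewrite card_nonzero_on ?enum_uniq ?card_upper_set //.
- by rewrite big_enum; congr (_ * _); apply: eq_bigr => h /card_end_set ->.
- move=> h h' _ _ hh'; rewrite disjoints_subset; apply/subsetP=> r; rewrite !inE.
  case/andP=> /eqP -> _; apply/negP=> /andP[/eqP e _].
  by case/eqP: hh'; apply: val_inj; exact: dpart_inj e.
- move=> h _; rewrite disjoints_subset; apply/subsetP=> r; rewrite !inE => h1.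
  by apply/negP=> /andP[_ /eqP e]; lia.
Qed.

End Shape.

(** * The three factors of the count *)
Lemma phiS (t : rat) m : phi m.+1 t = phi m t * (1 - t ^+ m.+1).
Proof. by rewrite /phi big_nat_recr. Qed.

(** Within the block of a part of multiplicity m the exponents run through
    m, ..., 1. Induction on the sequence adds a part that is the largest. *)
Lemma prod_phi_mult (t : rat) (lam : seq nat) : sorted geq lam ->
  \prod_(i < size lam) (1 - t ^+ (count (leq (nth 0%N lam i)) lam - i)) =
  \prod_(x <- undup lam) phi (count_mem x lam) t.
Proof.
elim: lam => [|x s IHs] srt; first by rewrite big_ord0 big_nil.
move: srt; rewrite /= (path_sortedE geq_trans) => /andP[xs srt].
rewrite big_ord_recl /= subn0 leqnn add1n.
have -> : count (leq x) s = count_mem x s.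
  apply: eq_in_count => y ys /=; have := allP xs y ys => /= h.
  by rewrite eqn_leq h.
rewrite (eq_bigr (fun i : 'I_(size s) =>
  1 - t ^+ (count (leq (nth 0%N s i)) s - i))); last first.
  move=> i _; rewrite /= /bump /= add1n.
  by have -> : (nth 0 s i <= x)%N by apply: (allP xs); rewrite mem_nth.
rewrite IHs //; have [xin|xnin] := boolP (x \in s).
  rewrite (bigD1_seq x) ?mem_undup ?undup_uniq //= [RHS](bigD1_seq x) ?mem_undup ?undup_uniq //=.
  rewrite eqxx add1n phiS mulrA [X in X * _]mulrC; congr (_ * _).
  by apply: eq_bigr => y yx; rewrite eq_sym (negbTE yx).
rewrite big_cons eqxx (count_memPn xnin) add1n phiS; congr (_ * _).
  by rewrite /phi big_geq // mul1r.
rewrite big_seq [RHS]big_seq; apply: eq_bigr => y; rewrite mem_undup => ys.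
by case: eqP => // e; move: xnin; rewrite e ys.
Qed.

Section Dimensions.
Variable lam : seq nat.
Local Notation n := (sumn lam).
Local Notation part := (nth 0%N lam).

Lemma kerdimE a : kerdim lam a = (\sum_(i < size lam) minn (part i) a)%N.
Proof.
rewrite /kerdim -sum1_card big_mkcond /=.
rewrite (eq_bigr (fun r : 'I_n => (fun _ j => (j < a : nat)%N) (blk lam r) (off lam r)));
  last by move=> r _; rewrite inE; case: (_ < _)%N.
rewrite (big_positions _ _ (fun _ j => (j < a : nat)%N)); apply: eq_bigr => i _.
elim: (part i) => [|p IHp]; first by rewrite big_ord0 min0n.
by rewrite big_ord_recr /= IHp; case: ltnP; lia.
Qed.

Lemma kerdim_pred a : (0 < a)%N ->
  kerdim lam a = (kerdim lam a.-1 + count (leq a) lam)%N.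
Proof.
move=> a0; rewrite !kerdimE -sum1_count (big_nth 0%N) big_mkord.
rewrite [X in (_ + X)%N]big_mkcond -big_split; apply: eq_bigr => i _ /=.
by case: leqP; lia.
Qed.

Hypothesis lamP : is_partition lam.

Lemma count_ge i : (i < size lam)%N -> (i < count (leq (part i)) lam)%N.
Proof.
move=> hi; rewrite -[X in count _ X](cat_take_drop i.+1 lam) count_cat.
apply: leq_trans (leq_addr _ _).
suff -> : count (leq (part i)) (take i.+1 lam) = i.+1 by [].
rewrite -[RHS](size_takel hi); apply/eqP; rewrite -all_count.
apply/(all_nthP 0%N) => j; rewrite size_takel // => hj.
by rewrite nth_take // is_partition_dec.
Qed.

(** This is the dimension of the centralizer of N, the sum over i and j of
    min(lam_i, lam_j). *)
Lemma sum_kerdim :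
  (\sum_(i < size lam) kerdim lam (part i) = n + 2 * nstat lam)%N.
Proof.
rewrite (eq_bigr (fun i : 'I_(size lam) =>
   \sum_(j < size lam) minn (part j) (part i))%N); last by move=> i _; exact: kerdimE.
have tri m : (m <= size lam)%N ->
    (\sum_(i < m) \sum_(j < m) minn (part j) (part i) =
     \sum_(i < m) part i + 2 * \sum_(i < m) i * part i)%N.
  elim: m => [|m IHm] hm; first by rewrite !big_ord0.
  rewrite big_ord_recr /=.
  rewrite (eq_bigr (fun i : 'I_m => \sum_(j < m) minn (part j) (part i) + part m)%N);
    last first.
    move=> i _; rewrite big_ord_recr /= (minn_idPl _) //.
    by apply: is_partition_dec => //; exact: ltnW.
  rewrite big_split /= IHm ?(ltnW hm) // sum_nat_const card_ord.
  rewrite (eq_bigr (fun=> part m)) => [|i _]; last first.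
    by apply/minn_idPr/is_partition_dec => //; rewrite -ltnS.
  rewrite sum_nat_const card_ord !big_ord_recr /=; lia.
rewrite tri // /nstat; congr (_ + _)%N.
exact: sum_nth.
Qed.

End Dimensions.

Lemma nstat_padd mu nu : (nstat (padd mu nu) = nstat mu + nstat nu)%N.
Proof.
have wide (s : seq nat) m : (size s <= m)%N -> (nstat s = \sum_(i < m) i * nth 0 s i)%N.
  move=> h; rewrite /nstat (big_ord_widen _ (fun i => i * nth 0 s i)%N h).
  rewrite big_mkcond; apply: eq_bigr => i _; case: ltnP => // h'.
  by rewrite nth_default ?muln0.
pose m := maxn (size mu) (size nu).
rewrite (wide _ m) ?size_mkseq // (wide mu m) ?leq_maxl // (wide nu m) ?leq_maxr //.
by rewrite -big_split; apply: eq_bigr => i _; rewrite nth_padd mulnDr.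
Qed.

Section RatCounts.
Variable F : finFieldType.
Local Notation q := (#|F|%:R : rat).

Lemma q_neq0 : q != 0.
Proof. by rewrite pnatr_eq0 -lt0n; apply/card_gt0P; exists 0. Qed.

Lemma natr_expB a b : (b <= a)%N ->
  (#|F| ^ a - #|F| ^ (a - b))%N%:R = q ^+ a * (1 - q^-1 ^+ b).
Proof.
move=> ba; rewrite natrB; last first.
  by apply: leq_pexp2l (leq_subr _ _); apply/card_gt0P; exists 0.
rewrite !natrX -[in LHS](subnK ba) addnK -[in RHS](subnK ba) !exprD exprVn.
by field; rewrite expf_neq0 // q_neq0.
Qed.

Lemma card_unitmx_rat n :
  (#|[set Q : 'M[F]_n | Q \in unitmx]|%:R : rat) = q ^+ (n ^ 2) * phi n q^-1.
Proof.
rewrite card_unitmx natr_prod.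
rewrite (eq_bigr (fun i : 'I_n => q ^+ n * (1 - q^-1 ^+ (n - i)))); last first.
  move=> i _; rewrite -natr_expB ?leq_subr // subKn // ltnW //.
rewrite big_split /= prodr_const card_ord -exprM mulnn; congr (_ * _).
rewrite /phi big_add1 big_mkord (reindex_inj rev_ord_inj) /=.
by apply: eq_bigr => i _; congr (1 - _ ^+ _); have := ltn_ord i; lia.
Qed.

Lemma card_centralizer_rat lam : is_partition lam ->
  (#|intertwiners (jordan_mx F lam)|%:R : rat) =
  q ^+ (sumn lam + 2 * nstat lam) *
  \prod_(h < ndparts lam) phi (mult lam h) q^-1.
Proof.
move=> lamP.
rewrite (card_intertwiners_rank (is_partition_dec lamP) (fun i => is_partition_gt0 lamP)) //.
rewrite natr_prod -sum_kerdim // -prodrXr.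
have -> : \prod_(h < ndparts lam) phi (mult lam h) q^-1 =
    \prod_(x <- undup lam) phi (count_mem x lam) q^-1.
  by rewrite (big_nth 0%N) big_mkord.
rewrite -prod_phi_mult; last by case/andP: lamP.
rewrite -big_split; apply: eq_bigr => i _ /=.
have hp := kerdim_pred lam (is_partition_gt0 lamP (ltn_ord i)).
have hc := count_ge lamP (ltn_ord i).
rewrite -natr_expB; last by lia.
by congr (_ - _ ^ _)%N%:R; lia.
Qed.

End RatCounts.

Theorem corollary2p13 (k : closedFieldType) (F : finFieldType)
    (iota : {rmorphism F -> k}) (n : nat) (mu nu : seq nat)
    (munuP : is_bipartition n mu nu) :
  let q : rat := #|F|%:R in
  let lam := padd mu nu in
  #|orbit_points iota n mu nu|%:R =
    q ^ ((n ^ 2)%N%:Z - (bstat mu nu)%:Z) * phi n q^-1 /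
    ((\prod_(h in Jset mu nu) phi (mult lam h).-1 q^-1) *
     (\prod_(h | h \notin Jset mu nu) phi (mult lam h) q^-1)).
Proof.
case/and4P: munuP => muP nuP lamP /eqP <- {n} q lam.
set n := sumn lam.
have q0 : q != 0 := q_neq0 F.
have q1 : 1 < q by rewrite ltr1n card_finNzRing_gt1.
have fac0 m : 1 - q^-1 ^+ m.+1 != 0.
  rewrite subr_eq0 eq_sym lt_eqF // exprn_ilt1 ?invr_ge0 ?ler0n //.
  by rewrite invf_lt1 // ltr0n; apply/card_gt0P; exists 0.
have phi0 m : phi m q^-1 != 0.
  elim: m => [|m IHm]; first by rewrite /phi big_geq ?oner_eq0.
  by rewrite phiS mulf_neq0.
have mult_gt0 (h : 'I_(ndparts lam)) : (0 < mult lam h)%N.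
  by rewrite /mult -has_count has_pred1 -mem_undup mem_nth.
have main := congr1 (fun m : nat => m%:R : rat) (card_orbit_points iota muP nuP lamP).
rewrite !natrM card_centralizer_rat // card_unitmx_rat card_generic_set // in main.
rewrite -/lam -/n -/q (bigID (fun h : 'I__ => h \in Jset mu nu)) /= in main.
have phiJ : \prod_(h in Jset mu nu) phi (mult lam h) q^-1 =
    \prod_(h in Jset mu nu) phi (mult lam h).-1 q^-1 *
    \prod_(h in Jset mu nu) (1 - q^-1 ^+ mult lam h).
  rewrite -big_split; apply: eq_bigr => h _ /=.
  by rewrite -{1 3}(prednK (mult_gt0 h)) phiS.
rewrite phiJ in main.
have nn : n = (sumn mu + sumn nu)%N.
  rewrite /n -(@sum_nth lam (size lam)) // -(@sum_nth mu (size lam)) -?(@sum_nth nu (size lam));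
    rewrite ?size_mkseq ?leq_maxl ?leq_maxr //.
  by rewrite -big_split; apply: eq_bigr => i _; rewrite nth_padd.
move: main.
set A := _%:R; set P := phi n _; set PJ := \prod_(h in _) phi _ _.
set PJ' := \prod_(h | _ \notin _) _; set D := \prod_(h in _) (1 - _) => main.
have PJ0 : PJ != 0 by apply/prodf_neq0 => h _.
have PJ'0 : PJ' != 0 by apply/prodf_neq0 => h _.
have D0 : D != 0 by apply/prodf_neq0 => h _; rewrite -(prednK (mult_gt0 h)).
have -> : q ^ ((n ^ 2)%N%:Z - (bstat mu nu)%:Z) =
    q ^+ (n ^ 2) * q ^+ (n - sumn nu) / q ^+ (n + 2 * nstat lam).
  have -> : (n ^ 2)%N%:Z - (bstat mu nu)%:Z =
     (n ^ 2 + (n - sumn nu))%N%:Z - (n + 2 * nstat lam)%N%:Z.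
    by rewrite /bstat nstat_padd; lia.
  by rewrite expfzDr // -exprnP -exprD exprnN.
apply: (mulIf (x := q ^+ (n + 2 * nstat lam) * (PJ * D * PJ'))).
  by rewrite !mulf_neq0 // expf_neq0.
rewrite main; field.
by rewrite PJ0 PJ'0 expf_neq0.
Qed.
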